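(* Let $S,T$ be disjoint finite sets, $V=S\cup T$, and let $f_V=(f_S,f_T)$, $g_V=(g_S,g_T)$ be functions with $f_V:V\to\mathbb{Z}\cup\{-\infty\}$, $g_V:V\to\mathbb{Z}\cup\{+\infty\}$, $f_V\le g_V$. Let $p_T$ be a positively intersecting supermodular function on $T$ with $p_T(\emptyset)=0$ and $p_T(Y)\le|S|$ for every $Y\subseteq T$. There is a simple bipartite graph $G=(S,T;E)$ covering $p_T$ (i.e. $|\Gamma_G(Y)|\ge p_T(Y)$ for all $Y\subseteq T$) with $f_V(v)\le d_G(v)\le g_V(v)$ for all $v\in V$ if and only if $$\widetilde f_T(Y)-|X||Y|+\widetilde p_T(\mathcal T)-|\mathcal T||X|\le\widetilde g_S(S-X)\quad(1)$$ and $$\widetilde f_S(X)-|X||Y|+\widetilde p_T(\mathcal T)-|\mathcal T||X|\le\widetilde g_T(T-Y)\quad(2)$$ hold for every $Y\subseteq T$, $X\subseteq S$, and subpartition $\mathcal T$ of $T-Y$. If $p_T$ is fully supermodular, it suffices to require (1) and (2) only for subpartitions $\mathcal T$ having at most one member. If $p_T$ is fully supermodular and monotone non-decreasing, it suffices to require (1) and (2) only for $\mathcal T=\emptyset$ and $\mathcal T=\{T-Y\}$.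
   Context: A bipartite graph is simple if it has no parallel edges; $\Gamma_G(Y)$ is the set of nodes of $S$ adjacent to some node of $Y$; $d_G(v)$ is the degree of $v$. For a function $h$, $\widetilde h(X)=\sum_{v\in X}h(v)$ (with the usual arithmetic of $\pm\infty$). A subpartition is a family of pairwise disjoint nonempty subsets (the empty family allowed, with $\widetilde p_T(\emptyset)=0$); $\widetilde p_T(\mathcal T)=\sum_{W\in\mathcal T}p_T(W)$. $p_T$ is positively intersecting supermodular if $p_T(X)+p_T(Y)\le p_T(X\cap Y)+p_T(X\cup Y)$ whenever $X\cap Y\ne\emptyset$, $p_T(X)>0$, $p_T(Y)>0$; fully supermodular if this holds for all $X,Y$; monotone non-decreasing if $p_T(X)\le p_T(Y)$ whenever $\emptyset\subset X\subseteq Y\subseteq T$. *)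

(* Defs.v *)
From HB Require Import structures.
From mathcomp Require Import all_boot all_order all_algebra.
From mathcomp Require Import constructive_ereal.

Set Implicit Arguments.
Unset Strict Implicit.
Unset Printing Implicit Defensive.

Import Order.TTheory GRing.Theory Num.Theory.

Local Open Scope ring_scope.

(* A simple bipartite graph G = (S, T; E) is given by its edge set
   E : {set S * T}: an edge is determined by its two ends, so there are no
   parallel edges.  The node set is the disjoint union S + T. *)

Definition Gamma (S T : finType) (E : {set S * T}) (Y : {set T}) : {set S} :=
  [set s : S | [exists t in Y, (s, t) \in E]].

Definition deg (S T : finType) (E : {set S * T}) (v : S + T) : nat :=
  match v with
  | inl s => #|[set e in E | e.1 == s]|
  | inr t => #|[set e in E | e.2 == t]|
  end.

Definition covers (S T : finType) (E : {set S * T}) (p : {set T} -> int) :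
    Prop :=
  forall Y : {set T}, p Y <= #|Gamma E Y|%:Z.

Definition degree_bounded (S T : finType) (E : {set S * T})
    (f g : S + T -> \bar int) : Prop :=
  forall v : S + T, (f v <= (deg E v)%:Z%:E <= g v)%E.

Definition pos_intersecting_supermodular (T : finType)
    (p : {set T} -> int) : Prop :=
  forall X Y : {set T}, X :&: Y != set0 -> 0 < p X -> 0 < p Y ->
    p X + p Y <= p (X :&: Y) + p (X :|: Y).

Definition fully_supermodular (T : finType) (p : {set T} -> int) : Prop :=
  forall X Y : {set T}, p X + p Y <= p (X :&: Y) + p (X :|: Y).

(* The empty set is exempt: p set0 may exceed values on nonempty sets. *)
Definition monotone_nondecreasing (T : finType) (p : {set T} -> int) : Prop :=
  forall X Y : {set T}, X != set0 -> X \subset Y -> p X <= p Y.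

Definition subpartition (T : finType) (P : {set {set T}}) (A : {set T}) :
    Prop :=
  [/\ trivIset P, set0 \notin P & cover P \subset A].

Definition tilde (V : finType) (h : V -> \bar int) (X : {set V}) : \bar int :=
  (\sum_(v in X) h v)%E.

(* Z extended with infinities is \bar int, whose addition has
   -oo + +oo = -oo; no such sum occurs below when f avoids +oo and g avoids
   -oo. *)
Definition condition1 (S T : finType) (f g : S + T -> \bar int)
    (p : {set T} -> int) (X : {set S}) (Y : {set T}) (P : {set {set T}}) :
    Prop :=
  (tilde (fun t => f (inr t)) Y - (#|X| * #|Y|)%N%:Z%:E
     + (\sum_(W in P) p W)%R%:E - (#|P| * #|X|)%N%:Z%:E
   <= tilde (fun s => g (inl s)) (~: X))%E.

Definition condition2 (S T : finType) (f g : S + T -> \bar int)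
    (p : {set T} -> int) (X : {set S}) (Y : {set T}) (P : {set {set T}}) :
    Prop :=
  (tilde (fun s => f (inl s)) X - (#|X| * #|Y|)%N%:Z%:E
     + (\sum_(W in P) p W)%R%:E - (#|P| * #|X|)%N%:Z%:E
   <= tilde (fun t => g (inr t)) (~: Y))%E.

(* Main.v *)
(* Prescribe upper bounds m_s on the degrees in S and lower bounds h_t on the
   degrees in T.  Replacing p({t}) by h_t keeps p positively intersecting
   supermodular, so one only has to cover a function p by neighbourhoods N(s)
   with |N(s)| <= m_s, and the condition reads p(P) <= q(|P|) for every
   subpartition P, where q(k) = sum_s min(m_s, k) is concave.  The sets N(s) are
   chosen one after the other, element by element: an element t may be added to
   N = N(s) unless some tight subpartition has no member that contains t and
   avoids N.  If every t were excluded in this way, the tight subpartitions could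
   be uncrossed, by concavity of q, into tight ones F_0, F_1, ... such that
   every member of F_(i+1) contains a member of F_i; then the points of a
   smallest member below an N-avoiding member of the last one are not excluded,
   a contradiction.

   For the two-sided bounds, infinite bounds are first truncated.  A maximal m
   between f_S and g_S that respects (2) also satisfies (1) in place of g_S, by
   uncrossing a smallest violation of (1) with a tight case of (2).  A maximal
   h between f_T and g_T that respects (1) for this m then has the same total
   as m, and all the degree bounds hold with equality. *)

Require Import Defs.
From HB Require Import structures.
From mathcomp Require Import all_boot all_order all_algebra.
From mathcomp Require Import constructive_ereal.
From mathcomp Require Import zify.

Set Implicit Arguments.
Unset Strict Implicit.
Unset Printing Implicit Defensive.

Import Order.TTheory GRing.Theory Num.Theory.

Local Open Scope ring_scope.

(* The type {set {set T}} is elaborated with a spurious reverse coercion, which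
   lia sees when it compares atoms. *)
Ltac slia := unfold reverse_coercion in *; lia.

(** * Families of disjoint nonempty sets and their weights *)

Definition subpart (T : finType) (P : {set {set T}}) : bool :=
  trivIset P && (set0 \notin P).

Lemma subpart_disjoint (T : finType) (P : {set {set T}}) (X Y : {set T}) x :
  subpart P -> X \in P -> Y \in P -> x \in X -> x \in Y -> X = Y.
Proof.
case/andP=> /trivIsetP tP _ XP YP xX xY; apply/eqP; apply: contraT => nXY.
have /pred0P/(_ x) := tP X Y XP YP nXY.
by rewrite /= xX xY.
Qed.

Lemma subpart_neq0 (T : finType) (P : {set {set T}}) (X : {set T}) :
  subpart P -> X \in P -> exists x, x \in X.
Proof. by case/andP=> _ P0 XP; apply/set0Pn; apply: contraNneq P0 => <-. Qed.

Lemma subpartI (T : finType) (P : {set {set T}}) :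
    (forall X Y x, X \in P -> Y \in P -> x \in X -> x \in Y -> X = Y) ->
    (forall X, X \in P -> exists x, x \in X) ->
  subpart P.
Proof.
move=> tP P0; apply/andP; split; last first.
  by apply/negP => /P0[x]; rewrite inE.
apply/trivIsetP => X Y XP YP nXY; apply/pred0P => x /=.
by apply/negP => /andP[xX xY]; rewrite (tP X Y x) ?eqxx in nXY.
Qed.

Lemma subpartS (T : finType) (P Q : {set {set T}}) :
  Q \subset P -> subpart P -> subpart Q.
Proof.
move=> /subsetP sQP sP; apply: subpartI => [X Y x /sQP XP /sQP YP|X /sQP XP].
  exact: subpart_disjoint XP YP.
exact: subpart_neq0 XP.
Qed.

Definition weight (T : finType) (h : {set T} -> int) (A : {set {set T}}) : int :=
  \sum_(W in A) h W.

Section Weight.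
Variable T : finType.
Implicit Types (A B Zs : {set {set T}}) (X Y : {set T}) (h : {set T} -> int).

Lemma weight0 h : weight h set0 = 0.
Proof. exact: big_set0. Qed.

Lemma weight1 A : weight (fun=> 1) A = #|A|%:Z.
Proof. by rewrite /weight sumr_const natz. Qed.

Lemma weight_setD1 A X h : X \in A -> weight h A = h X + weight h (A :\ X).
Proof. by move=> XA; rewrite /weight (big_setD1 X XA). Qed.

Lemma weight_setU A B h :
  [disjoint A & B] -> weight h (A :|: B) = weight h A + weight h B.
Proof.
move=> dAB; rewrite /weight (eq_bigl [predU A & B]) => [|j].
  by rewrite bigU.
by rewrite !inE.
Qed.

Lemma weight_setD A B h :
  B \subset A -> weight h A = weight h (A :\: B) + weight h B.
Proof.
by move=> sBA; rewrite /weight (big_setID B) /= (setIidPr sBA) addrC.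
Qed.

Lemma weight_setU1 A X h : X \notin A -> weight h (X |: A) = h X + weight h A.
Proof. by move=> XA; rewrite /weight (big_setU1 _ XA). Qed.

End Weight.

(** * Uncrossing subpartitions *)

(** The members of [Ys] are joined to [X] one at a time. By disjointness each step has intersection
    [X :&: Y], so supermodularity applies while the union keeps a positive value. The first time it
    does not, its term is dropped and [Zs] is what has been joined so far. *)
Lemma absorb (T : finType) (p : {set T} -> int) (X : {set T})
    (Ys : {set {set T}}) :
    pos_intersecting_supermodular p -> 0 < p X -> subpart Ys ->
    (forall Y, Y \in Ys -> X :&: Y != set0 /\ (0 < p Y \/ Y \subset X)) ->
  (0 < p (X :|: cover Ys) /\
     p X + weight p Ys
       <= p (X :|: cover Ys) + weight (fun Y => p (X :&: Y)) Ys) \/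
  (exists2 Zs : {set {set T}}, Zs \subset Ys &
     p X + weight p Zs <= weight (fun Y => p (X :&: Y)) Zs).
Proof.
move=> p_super pX.
have [n] := ubnP #|Ys|; elim: n Ys => // n IHn Ys leYs sYs meetX.
have [->|[Y YYs]] := set_0Vmem Ys.
  by left; rewrite /cover big_set0 !weight0 setU0 !addr0.
have sD : Ys :\ Y \subset Ys by apply: subsetDl.
case: (IHn (Ys :\ Y)) => [|||[pXc le1]|[Zs sZ le1]].
- by move: leYs; rewrite (cardsD1 Y) YYs; lia.
- exact: subpartS sYs.
- by move=> Z /(subsetP sD)/meetX.
- have cE : cover Ys = cover (Ys :\ Y) :|: Y.
    by rewrite /cover (big_setD1 Y) //= setUC.
  have IE : (X :|: cover (Ys :\ Y)) :&: Y = X :&: Y.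
    rewrite setIUl [X in _ :|: X](_ : _ = set0) ?setU0 //.
    apply/setP => x; rewrite !inE; apply/negP => /andP[/bigcupP[Z]].
    rewrite !inE => /andP[nZY ZYs] xZ xY.
    by rewrite (subpart_disjoint sYs ZYs YYs xZ xY) eqxx in nZY.
  have [mY posY] := meetX Y YYs.
  have key : p (X :|: cover (Ys :\ Y)) + p Y
      <= p (X :|: cover Ys) + p (X :&: Y).
    case: posY => [pY|YX].
      have := p_super (X :|: cover (Ys :\ Y)) Y; rewrite IE -setUA -cE => /(_ mY pXc pY).
      by lia.
    have -> : X :|: cover Ys = X :|: cover (Ys :\ Y).
      by rewrite cE (setUC _ Y) setUA (setUidPl YX).
    by rewrite (setIidPr YX).
  case: (ltP 0 (p (X :|: cover Ys))) => [pos|npos].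
    by left; split=> //; rewrite !(weight_setD1 _ YYs); slia.
  by right; exists Ys; rewrite ?subxx // !(weight_setD1 _ YYs); slia.
- by right; exists Zs => //; apply: subset_trans sZ sD.
Qed.

Section Surgery.
Variable T : finType.
Implicit Types (A B Zs : {set {set T}}) (X Y Z : {set T}).

(** Uncrossing [X] in one family with [Zs] in another: [cut] puts the intersections into the first,
    [merge] puts the union into the second. *)
Definition cut A X Zs := (A :\ X) :|: [set X :&: Y | Y in Zs].

Definition merge B Z Zs := Z |: (B :\: Zs).

Lemma in_cut A X Zs W :
  W \in cut A X Zs -> (W \in A /\ W != X) \/ exists2 Y, Y \in Zs & W = X :&: Y.
Proof.
case/setUP=> [/setD1P[nW WA]|/imsetP[Y YZ ->]]; first by left.
by right; exists Y.
Qed.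

Lemma subpart_cut A X Zs :
    subpart A -> X \in A -> subpart Zs ->
    (forall Y, Y \in Zs -> X :&: Y != set0) ->
  subpart (cut A X Zs).
Proof.
move=> sA XA sZ meetX; apply: subpartI; last first.
  move=> W /in_cut[[WA _]|[Y YZ ->]]; first exact: subpart_neq0 WA.
  exact/set0Pn/meetX.
move=> V W x /in_cut[[VA nV]|[Y YZ ->]] /in_cut[[WA nW]|[Z ZZ ->]].
- exact: subpart_disjoint VA WA.
- move=> xV /setIP[xX _]; move: nV.
  by rewrite (subpart_disjoint sA VA XA xV xX) eqxx.
- move=> /setIP[xX _] xW; move: nW.
  by rewrite (subpart_disjoint sA WA XA xW xX) eqxx.
- move=> /setIP[_ xY] /setIP[_ xZ].
  by rewrite (subpart_disjoint sZ YZ ZZ xY xZ).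
Qed.

(** The traces are distinct and not in [A :\ X]. Leaving [h] arbitrary lets one identity count
    values, members and elements. *)
Lemma weight_cut A X Zs (h : {set T} -> int) :
    subpart A -> X \in A -> subpart Zs ->
    (forall Y, Y \in Zs -> X :&: Y != set0) ->
  weight h (cut A X Zs) + h X = weight h A + weight (fun Y => h (X :&: Y)) Zs.
Proof.
move=> sA XA sZ meetX; rewrite weight_setU; last first.
  apply/pred0P => W /=; apply/negP => /andP[/setD1P[nW WA] /imsetP[Y YZ WE]].
  have /set0Pn[x] := meetX Y YZ; rewrite -WE => xW.
  have xX : x \in X by move: xW; rewrite WE => /setIP[].
  by rewrite (subpart_disjoint sA WA XA xW xX) eqxx in nW.
have -> : weight h [set X :&: Y | Y in Zs] = weight (fun Y => h (X :&: Y)) Zs.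
  rewrite /weight big_imset // => Y Z YZ ZZ E; have /set0Pn[x xXY] := meetX Y YZ.
  have xXZ := xXY; rewrite E in xXZ.
  case/setIP: xXY xXZ => _ xY /setIP[_ xZ].
  exact: subpart_disjoint sZ YZ ZZ xY xZ.
by rewrite (weight_setD1 h XA); slia.
Qed.

Lemma subpart_merge B Z Zs :
    subpart B -> (exists x, x \in Z) ->
    (forall Y x, Y \in B -> Y \notin Zs -> x \in Y -> x \notin Z) ->
  subpart (merge B Z Zs).
Proof.
move=> sB Z0 disZ; apply: subpartI; last first.
  move=> W /setU1P[->//|/setDP[WB _]]; exact: subpart_neq0 WB.
move=> V W x /setU1P[->|/setDP[VB nV]] /setU1P[->|/setDP[WB nW]] //.
- by move=> xZ xW; rewrite (negPf (disZ W x WB nW xW)) in xZ.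
- by move=> xV xZ; rewrite (negPf (disZ V x VB nV xV)) in xZ.
- exact: subpart_disjoint VB WB.
Qed.

Lemma weight_merge B Z Zs (h : {set T} -> int) :
    Zs \subset B -> (exists x, x \in Z) ->
    (forall Y x, Y \in B -> Y \notin Zs -> x \in Y -> x \notin Z) ->
  weight h (merge B Z Zs) + weight h Zs = weight h B + h Z.
Proof.
move=> sZ [z zZ] disZ; rewrite weight_setU1; last first.
  apply/negP => /setDP[ZB nZ].
  by have := disZ Z z ZB nZ zZ; rewrite zZ.
by rewrite (weight_setD h sZ); slia.
Qed.

End Surgery.

(** * Reducing a pair of families *)

Definition untouched (T : finType) (N : {set T}) (A : {set {set T}}) (x : T) :=
  [exists W in A, (x \in W) && [disjoint W & N]].

(* The last clause says that no point becomes common to the N-avoiding parts of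
   both families; the points avoided by one family only may change. *)
Definition reduces (T : finType) (p : {set T} -> int)
    (A B A' B' : {set {set T}}) : Prop :=
  [/\ subpart A' && subpart B',
      weight p A + weight p B <= weight p A' + weight p B',
      (#|B'| <= minn #|A| #|B|)%N && (#|A'| + #|B'| <= #|A| + #|B|)%N,
      (forall t, ([set t] \in A) || ([set t] \in B) ->
                 ([set t] \in A') || ([set t] \in B'))
    & (forall N x, untouched N A' x -> untouched N B' x ->
                   untouched N A x && untouched N B x)].

(** Progress means fewer members in total or a smaller second family; failing that, [mass_decr] lets
    elements pass from the first family to the second at fixed sizes. *)
Definition size_decr (T : finType) (A B A' B' : {set {set T}}) : bool :=
  (#|A'| + #|B'| < #|A| + #|B|)%N ||
  ((#|A'| + #|B'| == #|A| + #|B|)%N && (#|B'| < #|B|)%N).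

Definition mass_decr (T : finType) (A B A' B' : {set {set T}}) : bool :=
  let w := weight (fun W : {set T} => #|W|%:Z) in
  [&& #|A'| == #|A|, #|B'| == #|B|, w A' < w A & w A' + w B' == w A + w B].

Section Reduce.
Variables (T : finType) (p : {set T} -> int).
Hypothesis p_super : pos_intersecting_supermodular p.
Implicit Types (A B Zs : {set {set T}}) (X Y Z W : {set T}).

Let progress A B := exists A' B', reduces p A B A' B' /\
  (size_decr A B A' B' || mass_decr A B A' B').

Lemma untouchedS N A B x : A \subset B -> untouched N A x -> untouched N B x.
Proof.
move=> /subsetP sAB /exists_inP[W /sAB WB H]; apply/exists_inP; by exists W.
Qed.

Lemma reduce_swap A B :
  subpart A -> subpart B -> (#|A| < #|B|)%N -> progress A B.
Proof.
move=> sA sB lAB; exists B, A; split; last by apply/orP; left; apply/orP; right; lia.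
split; [by rewrite sA sB|lia|lia|by move=> t; rewrite orbC|].
by move=> N x -> ->.
Qed.

Let card_setD1 A X : X \in A -> #|A| = #|A :\ X|.+1.
Proof. by move=> XA; rewrite (cardsD1 X) XA. Qed.

(** Dropping a nonpositive member loses no weight. Singletons are spared because [reduces] must
    preserve them. *)
Lemma reduce_removeA A B X : subpart A -> subpart B -> (#|B| <= #|A|)%N ->
  X \in A -> #|X| != 1%N -> p X <= 0 -> progress A B.
Proof.
move=> sA sB lBA XA X1 pX; exists (A :\ X), B.
have cA := card_setD1 XA.
split; last by apply/orP; left; apply/orP; left; slia.
split.
- by rewrite sB (subpartS (subsetDl _ _) sA).
- by rewrite (weight_setD1 _ XA); slia.
- slia.
- move=> t; rewrite in_setD1; have [tX|//] := eqVneq [set t] X; move: X1.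
  by rewrite -tX cards1.
- by move=> N x /(untouchedS (subsetDl _ _)) -> ->.
Qed.

Lemma reduce_removeB A B X : subpart A -> subpart B -> (#|B| <= #|A|)%N ->
  X \in B -> #|X| != 1%N -> p X <= 0 -> progress A B.
Proof.
move=> sA sB lBA XB X1 pX; exists A, (B :\ X).
have cB := card_setD1 XB.
split; last by apply/orP; left; apply/orP; left; slia.
split.
- by rewrite sA (subpartS (subsetDl _ _) sB).
- by rewrite (weight_setD1 _ XB); slia.
- slia.
- move=> t; rewrite in_setD1; have [tX|//] := eqVneq [set t] X; move: X1.
  by rewrite -tX cards1.
- by move=> N x -> /(untouchedS (subsetDl _ _)) ->.
Qed.

Lemma reduce_move A B Y : subpart A -> subpart B -> (#|B| <= #|A|)%N ->
  Y \in B -> (forall X, X \in A -> [disjoint X & Y]) -> progress A B.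
Proof.
move=> sA sB lBA YB disY.
have YA : Y \notin A.
  apply/negP => YA; have [y yY] := subpart_neq0 sB YB.
  by have := disjointFr (disY Y YA) yY; rewrite yY.
exists (Y |: A), (B :\ Y); have cB := card_setD1 YB.
have cA : #|Y |: A| = #|A|.+1 by rewrite cardsU1 YA.
split; last by apply/orP; left; apply/orP; right; slia.
split.
- rewrite (subpartS (subsetDl _ _) sB) andbT; apply: subpartI.
    move=> V W x /setU1P[->|VA] /setU1P[->|WA] //.
    + by move=> xY xW; rewrite (disjointFr (disY W WA) xW) in xY.
    + by move=> xV xY; rewrite (disjointFr (disY V VA) xV) in xY.
    + exact: subpart_disjoint VA WA.
  move=> V /setU1P[->|VA]; first exact: subpart_neq0 YB.
  exact: subpart_neq0 VA.
- by rewrite (weight_setD1 _ YB) weight_setU1 //; slia.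
- slia.
- by move=> t; rewrite in_setU1 in_setD1; case: (_ == Y).
- move=> N x /exists_inP[W WA /andP[xW dW]] uB.
  have uB' := untouchedS (subsetDl _ _) uB; rewrite uB' andbT.
  case/setU1P: WA => [WY|WA]; last by apply/exists_inP; exists W; rewrite ?xW.
  case/exists_inP: uB => V /setD1P[VY VB] /andP[xV _].
  by rewrite (subpart_disjoint sB VB YB xV) ?eqxx // -WY in VY.
Qed.

Lemma single_cut A B X Zs t :
    #|X| != 1%N -> (forall Y, Y \in Zs -> X :&: Y != set0) ->
    ([set t] \in A) || ([set t] \in B) ->
  ([set t] \in cut A X Zs) || ([set t] \in B :\: Zs).
Proof.
move=> X1 mZ /orP[tA|tB].
  rewrite in_setU in_setD1 tA andbT; have [tX|//] := eqVneq [set t] X.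
  by rewrite -tX cards1 in X1.
rewrite in_setD tB andbT; have [tZ|] := boolP ([set t] \in Zs); last by rewrite orbT.
rewrite orbF in_setU; apply/orP; right; apply/imsetP; exists [set t] => //.
apply/esym/setIidPr; rewrite sub1set; have /set0Pn[x] := mZ _ tZ.
by case/setIP=> xX /set1P <-.
Qed.

(** A point of a trace [X :&: Y] lies in [Y], which has left [B], so by disjointness no remaining
    member of [B] contains it. *)
Lemma untouched_cut A B X Zs N x : subpart B ->
    untouched N (cut A X Zs) x -> untouched N (B :\: Zs) x -> Zs \subset B ->
  untouched N A x && untouched N B x.
Proof.
move=> sB /exists_inP[W WA /andP[xW dW]] uB /subsetP sZ.
rewrite (untouchedS (subsetDl _ _) uB) andbT.
case/in_cut: WA => [[WA _]|[Y YZ WE]]; first by apply/exists_inP; exists W; rewrite ?xW.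
case/exists_inP: uB => V /setDP[VB nV] /andP[xV _].
have xY : x \in Y by move: xW; rewrite WE => /setIP[].
by rewrite (subpart_disjoint sB VB (sZ Y YZ) xV xY) YZ in nV.
Qed.

(* All the members of B that meet X are absorbed at once, since uncrossing X
   with a single one would leave B without disjointness. *)
Lemma reduce_uncross A B X Y0 : subpart A -> subpart B -> (#|B| <= #|A|)%N ->
    (forall W, W \in A -> #|W| != 1%N -> 0 < p W) ->
    (forall W, W \in B -> #|W| != 1%N -> 0 < p W) ->
    X \in A -> Y0 \in B -> X :&: Y0 != set0 ->
    (forall Y, Y \in B -> ~~ (X \subset Y)) ->
  progress A B.
Proof.
move=> sA sB lBA pA pB XA YB meetX nXB.
have single W x : #|W| = 1%N -> x \in W -> W = [set x].
  by move/eqP/cards1P=> [y ->] /set1P->.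
have nX1 : #|X| != 1%N.
  apply/negP => /eqP X1; have /set0Pn[x /setIP[xX xY]] := meetX.
  by have := nXB Y0 YB; rewrite (single X x X1 xX) sub1set xY.
have pX := pA X XA nX1.
pose Ys := [set Y in B | X :&: Y != set0].
have sYB : Ys \subset B by apply/subsetP => Y /setIdP[].
have mYs Y : Y \in Ys -> X :&: Y != set0 by case/setIdP.
have sYs := subpartS sYB sB.
have [Y YYs|[ptop sup]|[Zs sZ sup]] := absorb p_super pX sYs.
- split; first exact: mYs.
  have [Y1|Y1] := eqVneq #|Y| 1%N; last by left; apply: pB => //; apply: (subsetP sYB).
  have /set0Pn[x /setIP[xX xY]] := mYs Y YYs.
  by right; rewrite (single Y x Y1 xY) sub1set.
- pose Z := X :|: cover Ys.
  have Z0 : exists x, x \in Z.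
    by have /set0Pn[x /setIP[xX _]] := meetX; exists x; rewrite inE xX.
  have disZ W x : W \in B -> W \notin Ys -> x \in W -> x \notin Z.
    move=> WB nW xW; apply/negP => /setUP[xX|/bigcupP[V VY xV]].
      by case/negP: nW; rewrite inE WB; apply/set0Pn; exists x; rewrite inE xX.
    have VB := subsetP sYB V VY.
    by rewrite (subpart_disjoint sB WB VB xW xV) VY in nW.
  have wA h := weight_cut h sA XA sYs mYs.
  have wB h := weight_merge h sYB Z0 disZ.
  have := wA (fun=> 1); have := wB (fun=> 1); rewrite !weight1 => cB cA.
  have Y0Ys : Y0 \in Ys by rewrite inE YB.
  have Ys1 : (0 < #|Ys|)%N by apply/card_gt0P; exists Y0.
  exists (cut A X Ys), (merge B Z Ys); split; last first.
    (* The sizes change by [#|Ys| - 1] in opposite directions. If [Y0] is alone, the elements of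
       [X :\: Y0] pass to the second family. *)
    have [Ys2|Ys2] := ltnP 1 #|Ys|.
      by apply/orP; left; apply/orP; right; slia.
    apply/orP; right.
    have YsE : Ys = [set Y0].
      apply/eqP; rewrite eq_sym eqEcard sub1set Y0Ys cards1; slia.
    have wY (h : {set T} -> int) : weight h Ys = h Y0 by rewrite YsE /weight big_set1.
    have := wA (fun W : {set T} => #|W|%:Z); have := wB (fun W : {set T} => #|W|%:Z).
    rewrite !wY.
    have ZE : Z = X :|: Y0 by rewrite /Z YsE /cover big_set1.
    have XY := cardsID Y0 X; have XU := cardsUI X Y0.
    have XD : (0 < #|X :\: Y0|)%N.
      by rewrite card_gt0 setD_eq0; apply: nXB.
    rewrite /mass_decr [in #|Z|]ZE => wB' wA'.
    have Y1 : #|Ys| = 1%N by rewrite YsE cards1.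
    by apply/and4P; split; move: cA cB wA' wB' Y1 XY XU XD; clear; slia.
  split.
  + by rewrite subpart_cut //= subpart_merge.
  + by have := wA p; have := wB p; move: sup; rewrite -/Z; slia.
  + slia.
  + move=> t /(single_cut nX1 mYs)/orP[->//|tB].
    by rewrite orbC in_setU1 tB orbT.
  + move=> N x uA /exists_inP[V /setU1P[VE|VB] /andP[xV dV]]; last first.
      by apply: (untouched_cut sB uA) sYB; apply/exists_inP; exists V; rewrite ?xV.
    (* If the union avoids [N], so do [X] and all of [Ys], which then serve as witnesses in the old
       families. *)
    rewrite {}VE in xV dV; have dS W (sW : W \subset Z) := disjointWl sW dV.
    have sYZ Y : Y \in Ys -> Y \subset Z.
      by move=> YY; rewrite subsetU // (bigcup_max Y) ?orbT.
    have sXZ : X \subset Z by apply: subsetUl.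
    case/exists_inP: uA => W /in_cut[[WA nW]|[Y YY ->]] /andP[xW dW].
      have uA : untouched N A x by apply/exists_inP; exists W; rewrite ?xW.
      move: xV; rewrite uA => /setUP[xX|/bigcupP[Y YY xY]].
        by rewrite (subpart_disjoint sA WA XA xW xX) eqxx in nW.
      apply/exists_inP; exists Y; first exact: subsetP sYB _ YY.
      by rewrite xY dS ?sYZ.
    case/setIP: xW => xX xY; apply/andP; split; apply/exists_inP.
      by exists X; rewrite ?xX ?dS.
    by exists Y; [exact: subsetP sYB _ YY|rewrite xY dS ?sYZ].
(* The union is not worth keeping: [Zs] leaves [B] without replacement and one member is lost in
   total. *)
- have sZB := subset_trans sZ sYB; have sZs := subpartS sZB sB.
  have mZs Y : Y \in Zs -> X :&: Y != set0 by move/(subsetP sZ)/mYs.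
  have wA h := weight_cut h sA XA sZs mZs.
  have := wA (fun=> 1); rewrite !weight1 => cA.
  have := weight_setD (fun=> 1) sZB; rewrite !weight1 => cB.
  exists (cut A X Zs), (B :\: Zs); split; last first.
    apply/orP; left; rewrite /size_decr; apply/orP; left; move: cA cB.
    by clear; slia.
  split.
  + by rewrite subpart_cut //= (subpartS (subsetDl _ _) sB).
  + by have := wA p; rewrite (weight_setD p sZB); move: sup; clear; slia.
  + by move: cA cB lBA; clear; slia.
  + by move=> t; apply: single_cut nX1 mZs.
  + by move=> N x uA uB; apply: untouched_cut sB uA uB sZB.
Qed.

(** If no reduction applies, each [Y] in [B] meets some [X] in [A], or it could be moved; and [X]
    lies in a member of [B], or it could be uncrossed. By disjointness that member is [Y]. *)
Lemma reduce_or_nested A B : subpart A -> subpart B ->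
  progress A B \/
  ((#|B| <= #|A|)%N /\
   forall Y, Y \in B -> exists2 X, X \in A & X \subset Y).
Proof.
move=> sA sB; have [lAB|lBA] := ltnP #|A| #|B|; first by left; apply: reduce_swap.
have [/exists_inP[X XA /andP[X1 pX]]|/exists_inPn npA] :=
  boolP [exists X in A, (#|X| != 1%N) && (p X <= 0)].
  by left; apply: reduce_removeA pX.
have [/exists_inP[X XB /andP[X1 pX]]|/exists_inPn npB] :=
  boolP [exists X in B, (#|X| != 1%N) && (p X <= 0)].
  by left; apply: reduce_removeB pX.
have [/exists_inP[Y YB /forall_inP dY]|/exists_inPn mB] :=
  boolP [exists Y in B, [forall X in A, [disjoint X & Y]]].
  by left; apply: reduce_move YB dY.
have [/exists_inP[X XA /andP[/exists_inP[Y YB mXY] /forall_inP nX]]|/exists_inPn nest] :=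
  boolP [exists X in A, [exists Y in B, X :&: Y != set0]
                     && [forall Y in B, ~~ (X \subset Y)]].
  left; apply: reduce_uncross XA YB mXY nX => // W WA W1; rewrite ltNge.
    by move: (npA W WA); rewrite W1.
  by move: (npB W WA); rewrite W1.
right; split=> // Y YB; have := mB Y YB; rewrite negb_forall_in.
case/exists_inP=> X XA mXY; exists X => //.
have /set0Pn[x /setIP[xX xY]] : X :&: Y != set0 by rewrite setI_eq0.
have := nest X XA; rewrite negb_and => /orP[/exists_inPn/(_ Y YB)|].
  by rewrite setI_eq0 mXY.
rewrite negb_forall_in => /exists_inP[V VB]; rewrite negbK => sXV.
by rewrite (subpart_disjoint sB YB VB xY (subsetP sXV x xX)).
Qed.

End Reduce.

(** * Descent to nested sequences of families *)

Definition nested (T : finType) (A B : {set {set T}}) : bool :=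
  (#|B| <= #|A|)%N && [forall Y in B, exists X in A, X \subset Y].

Lemma exchange_lt (s s' x y a : nat) :
  (s' + x = s + y -> y < x -> s < a.+1 -> s' < a)%N.
Proof. lia. Qed.

Section Stabilize.
Variables (T : finType) (p : {set T} -> int) (n : nat).
Hypothesis p_super : pos_intersecting_supermodular p.
Implicit Types (F G : 'I_n -> {set {set T}}) (A B : {set {set T}}).

Definition update F (i : 'I_n) A (j : 'I_n) B : 'I_n -> {set {set T}} :=
  fun k => if k == i then A else if k == j then B else F k.

Lemma sum_update F (i j : 'I_n) A B (c : 'I_n -> nat) (h : {set {set T}} -> nat) :
    (i < j)%N ->
  (\sum_k c k * h (update F i A j B k) + (c i * h (F i) + c j * h (F j))
    = \sum_k c k * h (F k) + (c i * h A + c j * h B))%N.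
Proof.
move=> ij; have nji : j != i by rewrite -val_eqE /= neq_ltn ij orbT.
rewrite !(bigD1 i (P := predT)) //= !(bigD1 j (P := fun k => k != i)) //=.
rewrite {1 2}/update !eqxx (negPf nji).
rewrite (eq_bigr (fun k => c k * h (F k))%N) => [|k /andP[ki kj]]; first lia.
by rewrite /update (negPf ki) (negPf kj).
Qed.

Let mass A := (\sum_(W in A) #|W|)%N.

Lemma weight_card A : weight (fun W : {set T} => #|W|%:Z) A = (mass A)%:Z.
Proof. by rewrite /weight /mass -[RHS]natz natr_sum; apply: eq_bigr => W _; rewrite natz. Qed.

(* Lexicographic descent: the weights k.+1 push sizes towards F 0, and at
   constant sizes the weights n - k push elements towards the last families. *)
Lemma stabilize (Inv : ('I_n -> {set {set T}}) -> Prop) :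
    (forall F, Inv F -> forall i, subpart (F i)) ->
    (forall F (i j : 'I_n) A B, Inv F -> (i < j)%N -> reduces p (F i) (F j) A B ->
       Inv (update F i A j B)) ->
  forall F, Inv F ->
  exists2 G, Inv G & forall i j : 'I_n, (i < j)%N -> nested (G i) (G j).
Proof.
move=> Inv_sub Inv_red F.
have [a] := ubnP (\sum_(k < n) k.+1 * #|F k|)%N; elim: a F => // a IHa F.
have [b] := ubnP (\sum_(k < n) (n - k) * mass (F k))%N; elim: b F => // b IHb F.
move=> leb lea iF.
have [/existsP[i /existsP[j /andP[ij nn]]]|/existsPn all_nested] :=
    boolP [exists i : 'I_n, [exists j : 'I_n, (i < j)%N && ~~ nested (F i) (F j)]];
  last first.
  exists F => // i j ij; have := all_nested i; rewrite negb_exists.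
  by move=> /forallP/(_ j); rewrite ij negbK.
have [[A [B [red meas]]]|[le12 nest]] :=
    reduce_or_nested p_super (Inv_sub F iF i) (Inv_sub F iF j); last first.
  case/negP: nn; rewrite /nested le12; apply/forall_inP => Y /nest[X XF sXY].
  by apply/exists_inP; exists X.
have iF' := Inv_red F i j A B iF ij red.
have := sum_update F A B (fun k => k.+1) (fun A => #|A|) ij.
have := sum_update F A B (fun k => n - k)%N mass ij.
case/orP: meas => [sd|md].
  move=> _ /= E; apply: (IHa (update F i A j B)) => //.
  case: red => _ _ /andP[leB leAB] _ _.
  have key : (i.+1 * #|A| + j.+1 * #|B| < i.+1 * #|F i| + j.+1 * #|F j|)%N.
    have [d dE] : exists d, nat_of_ord j = (i + d.+1)%N by exists (j - i).-1; lia.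
    rewrite dE; move: sd leB leAB; rewrite /size_decr; clear; move: (nat_of_ord i).
    move: #|F i| #|F j| #|A| #|B| => x y x' y' k.
    nia.
  exact: exchange_lt E key lea.
move=> /= E1 E2; apply: IHb.
- case/and4P: md => _ _; rewrite !weight_card => lA /eqP eAB.
  have nj := ltn_ord j.
  have key : ((n - i) * mass A + (n - j) * mass B
              < (n - i) * mass (F i) + (n - j) * mass (F j))%N.
    have [d dE] : exists d, (n - i = (n - j) + d.+1)%N by exists (j - i).-1; lia.
    rewrite dE; move: lA eAB; clear; move: (n - j)%N (mass A) (mass B).
    move: (mass (F i)) (mass (F j)) => x y k x' y'.
    nia.
  exact: exchange_lt E1 key leb.
- by case/and4P: md E2 => /eqP-> /eqP-> _ _ /addIn->.
- exact: iF'.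
Qed.

End Stabilize.

(** [stabilize] for two families. By nestedness a singleton of [Q] contains a member of [P], which
    must equal it, so [P] collects all singletons. *)
Lemma uncross_pair (T : finType) (p : {set T} -> int) (A B : {set {set T}}) :
    pos_intersecting_supermodular p -> subpart A -> subpart B ->
  exists P Q, [/\ subpart P && subpart Q,
    weight p A + weight p B <= weight p P + weight p Q,
    (#|Q| <= minn #|A| #|B|)%N && (#|P| + #|Q| <= #|A| + #|B|)%N
    & forall t, ([set t] \in A) || ([set t] \in B) -> [set t] \in P].
Proof.
move=> p_super sA sB.
pose i0 : 'I_2 := ord0; pose i1 : 'I_2 := ord_max.
(* Only the smaller size is bounded; nestedness makes it the size of the second family. *)
pose Inv (F : 'I_2 -> {set {set T}}) := [/\ subpart (F i0) && subpart (F i1),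
   weight p A + weight p B <= weight p (F i0) + weight p (F i1),
   (minn #|F i0| #|F i1| <= minn #|A| #|B|)%N && (#|F i0| + #|F i1| <= #|A| + #|B|)%N
   & forall t, ([set t] \in A) || ([set t] \in B) ->
               ([set t] \in F i0) || ([set t] \in F i1)].
have ordE (i : 'I_2) : i = i0 \/ i = i1.
  by case: i => [[|[|//]] lt]; [left|right]; apply: val_inj.
have [|||G [sG wG cG tG] nG] :=
  @stabilize T p 2 p_super Inv _ _ (fun i => if i == i0 then A else B).
- by move=> F [/andP[s0 s1] _ _ _] i; case: (ordE i) => ->.
- move=> F i j A' B' [sF wF cF tF] ij.
  have -> : i = i0 by case: (ordE i) ij => -> //; case: (ordE j) => ->.
  have -> : j = i1 by case: (ordE j) ij => -> //; rewrite ltn0.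
  have u0 : update F i0 A' i1 B' i0 = A' by [].
  have u1 : update F i0 A' i1 B' i1 = B' by [].
  case=> sA' wA' cA' tA' _; rewrite /Inv u0 u1; split=> //.
  + exact: le_trans wF wA'.
  + by move: cF cA'; clear; slia.
  + by move=> t /tF/tA'.
- by rewrite /Inv /=; split=> //; [rewrite sA sB|rewrite !leqnn].
have /andP[le10 /forall_inP nest] := nG i0 i1 isT.
exists (G i0), (G i1); split=> //; first by move: cG le10; clear; slia.
move=> t /tG/orP[//|t1]; have /exists_inP[X XG sX] := nest _ t1.
have /andP[s0 _] := sG; have [x xX] := subpart_neq0 s0 XG.
have /set1P xt := subsetP sX x xX.
suff -> : [set t] = X by [].
by apply/eqP; rewrite eq_sym eqEsubset sX sub1set -xt xX.
Qed.

(* Holds for concave nondecreasing q. *)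
Definition spreading (q : nat -> int) : Prop :=
  forall a b a' b', (b' <= minn a b)%N -> (a' + b' <= a + b)%N ->
    q a' + q b' <= q a + q b.

Lemma common_untouched (T : finType) (p : {set T} -> int) (N : {set T})
    (q : nat -> int) (P0 : {set {set T}}) :
    pos_intersecting_supermodular p -> spreading q ->
    (forall P, subpart P -> weight p P <= q #|P|) ->
    (forall P, subpart P -> q #|P| <= weight p P ->
       exists2 W, W \in P & [disjoint W & N]) ->
    subpart P0 -> q #|P0| <= weight p P0 ->
  exists t, forall P, subpart P -> q #|P| <= weight p P -> untouched N P t.
Proof.
move=> p_super q_spread p_le_q free sP0 qP0.
pose tight P := subpart P && (q #|P| <= weight p P).
have [/existsP[t /forallP tP]|/existsPn nocommon] :=
    boolP [exists t, [forall P, tight P ==> untouched N P t]].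
  by exists t => P sP qP; apply: (implyP (tP P)); rewrite /tight sP.
(* A tight family that excludes [t]; it exists by [nocommon], so the default is never taken. *)
pose miss t := odflt P0 [pick P | tight P && ~~ untouched N P t].
have missP t : tight (miss t) && ~~ untouched N (miss t) t.
  rewrite /miss; case: pickP => [P ->//|none] /=; case/negP: (nocommon t).
  by apply/forallP => P; have := none P; rewrite /=; case: (tight P) => //= /negbFE.
(* The extra last index takes the default [P0], a tight family, so the sequence is nonempty even for
   empty [T]. *)
pose F (k : 'I_#|T|.+1) := nth P0 [seq miss t | t <- enum T] k.
pose Inv (F : 'I_#|T|.+1 -> {set {set T}}) :=
  (forall k, tight (F k)) /\ (forall t, exists k, ~~ untouched N (F k) t).
have tight_sub P : tight P -> subpart P by case/andP.
have [|||G [tG uG] nG] := @stabilize T p _ p_super Inv _ _ F.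
- by move=> H [tH _] i; apply: tight_sub.
- move=> H i j A B [tH uH] ij [/andP[sA sB] wAB cAB _ uAB].
  have /andP[sHi qHi] := tH i; have /andP[sHj qHj] := tH j.
  (* Each new weight is at most its value of [q], while their sum is at least the sum of these
     values; hence both new families are tight. *)
  have qAB : q #|A| + q #|B| <= q #|H i| + q #|H j|.
    by case/andP: cAB; apply: q_spread.
  have qA := p_le_q A sA; have qB := p_le_q B sB.
  have tA : tight A by rewrite /tight sA; move: qAB qB wAB qHi qHj; clear; lia.
  have tB : tight B by rewrite /tight sB; move: qAB qA wAB qHi qHj; clear; lia.
  split=> [k|t]; first by rewrite /update; case: (k == i) => //; case: (k == j).
  have nji : j != i by rewrite -val_eqE /= neq_ltn ij orbT.
  have [k nk] := uH t.
  have [uA|] := boolP (untouched N A t); last by exists i; rewrite /update eqxx.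
  have [uB|] := boolP (untouched N B t); last by exists j; rewrite /update eqxx (negPf nji).
  have /andP[ui uj] := uAB N t uA uB.
  exists k; rewrite /update; case: (eqVneq k i) nk => [->|_]; first by rewrite ui.
  by case: (eqVneq k j) => [->|_ //]; rewrite uj.
- split=> [k|t].
    have [lt|le] := ltnP k (size (enum T)).
      have [t0 _] : exists t : T, true.
        by case: (enum T) lt => [|t l _]; [rewrite ltn0|exists t].
      by rewrite /F (nth_map t0) //; case/andP: (missP (nth t0 (enum T) k)).
    by rewrite /F nth_default ?(size_map miss (enum T)) //; apply/andP.
  have lt : (index t (enum T) < #|T|)%N by rewrite cardE index_mem mem_enum.
  exists (Ordinal (ltnW lt : index t (enum T) < #|T|.+1)%N).
  rewrite /F /= (nth_map t) ?index_mem ?mem_enum // nth_index ?mem_enum //.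
  by case/andP: (missP t).
(* Descending through the nesting finds a point of [Y] lying, in every earlier family, in a member
   contained in [Y]. For an [N]-avoiding [Y] of the last family, no family misses this point. *)
have chain (k : 'I_#|T|.+1) Y : Y \in G k ->
    exists2 x, x \in Y & forall j : 'I_#|T|.+1, (j <= k)%N ->
      exists W, [/\ W \in G j, x \in W & W \subset Y].
  case: k => k; elim: k Y => [|k IHk] Y lt YG.
    have [x xY] := subpart_neq0 (tight_sub _ (tG _)) YG.
    exists x => // j j0; exists Y; split=> //.
    by have <- : Ordinal lt = j by apply: val_inj => /=; move: j0 => /=; lia.
  have lt' : (k < #|T|.+1)%N by apply: ltnW.
  have /andP[_ /forall_inP nest] := nG (Ordinal lt') (Ordinal lt) (ltnSn k).
  have /exists_inP[X XG sXY] := nest Y YG.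
  have [x xX HX] := IHk X lt' XG; exists x; first exact: subsetP sXY x xX.
  move=> j; rewrite leq_eqVlt => /orP[/eqP jE|/HX[W [WG xW sWX]]]; last first.
    by exists W; split=> //; apply: subset_trans sXY.
  exists Y; split=> //; last exact: subsetP sXY x xX.
  by have <- : Ordinal lt = j by apply: val_inj.
have /andP[sG qG] := tG ord_max; have [Y YG dY] := free _ sG qG.
have [x _ Hx] := chain ord_max Y YG; have [k /negP[]] := uG x.
have [W [WG xW sWY]] := Hx k (leq_ord k).
by apply/exists_inP; exists W; rewrite // xW (disjointWl sWY dY).
Qed.

(** * Covering with upper bounds on one side *)

(** The demand left once a node of [S] has received the neighbourhood [N]. *)
Definition residual (T : finType) (p : {set T} -> int) (N : {set T})
    (W : {set T}) : int := p W - (~~ [disjoint W & N] : nat)%:Z.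

(** The indicator of meeting [N] is submodular, and a positive residual forces a positive [p]. *)
Lemma residual_super (T : finType) (p : {set T} -> int) (N : {set T}) :
  pos_intersecting_supermodular p ->
  pos_intersecting_supermodular (residual p N).
Proof.
move=> p_super X Y mXY pX pY.
have posp W : 0 < residual p N W -> 0 < p W.
  by rewrite /residual; case: disjoint; clear; lia.
have sup := p_super X Y mXY (posp X pX) (posp Y pY).
have dU : [disjoint X :|: Y & N] = [disjoint X & N] && [disjoint Y & N].
  by rewrite -!setI_eq0 setIUl setU_eq0.
have dX : [disjoint X & N] -> [disjoint X :&: Y & N].
  by apply: disjointWl; apply: subsetIl.
have dY : [disjoint Y & N] -> [disjoint X :&: Y & N].
  by apply: disjointWl; apply: subsetIr.
move: sup dX dY; rewrite /residual dU.
case: [disjoint X & N]; case: [disjoint Y & N]; case: [disjoint _ & N];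
  rewrite ?implybT /= => sup dX dY;
  first [by have := dX isT | by have := dY isT | by move: sup; clear; lia].
Qed.

Lemma weight_residual_hit (T : finType) (p : {set T} -> int) (N : {set T})
    (P : {set {set T}}) :
    (forall W, W \in P -> ~~ [disjoint W & N]) ->
  weight (residual p N) P + #|P|%:Z = weight p P.
Proof.
move=> hit; rewrite -weight1 /weight -big_split /=; apply: eq_bigr => W WP.
by rewrite /residual hit //= subrK.
Qed.

Lemma residual_setU1 (T : finType) (p : {set T} -> int) (N : {set T}) t W :
  residual p (t |: N) W + ((t \in W) && [disjoint W & N] : nat)%:Z
    = residual p N W.
Proof.
rewrite /residual; have -> : [disjoint W & t |: N] = (t \notin W) && [disjoint W & N].
  by rewrite -!setI_eq0 setIUr setU_eq0 setI_eq0 disjoint_sym disjoints1.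
by case: (t \in W); case: disjoint => /=; clear; lia.
Qed.

Lemma weight_le (T : finType) (g h : {set T} -> int) (P : {set {set T}}) :
  (forall W, W \in P -> g W <= h W) -> weight g P <= weight h P.
Proof. by move=> le; apply: ler_sum => W /le. Qed.

Lemma hitting_set (T : finType) (p : {set T} -> int) (q : nat -> int) (m : nat) :
    pos_intersecting_supermodular p -> spreading q ->
    (forall P, subpart P -> weight p P <= q #|P| + (minn m #|P|)%:Z) ->
  exists N : {set T}, (#|N| <= m)%N /\
    forall P, subpart P -> weight (residual p N) P <= q #|P|.
Proof.
move=> p_super q_spread le_q.
(* [k] bounds both the points still to be added and the excess over [q]; each new point pays for one
   unit. *)
suff grow k (N : {set T}) :
    (forall P, subpart P -> weight (residual p N) P <= q #|P| + k%:Z) ->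
  exists N' : {set T}, (#|N'| <= #|N| + k)%N /\
    forall P, subpart P -> weight (residual p N') P <= q #|P|.
  have [|N] := grow m set0; last by rewrite cards0; exists N.
  move=> P sP; apply: le_trans (_ : weight p P <= _).
    by apply: weight_le => W _; rewrite /residual; clear; lia.
  by have := le_q P sP; clear; lia.
elim: k N => [|k IHk] N leN.
  by exists N; split=> [|P sP]; [clear; lia|have := leN P sP; rewrite addr0].
pose tight P := subpart P && (q #|P| + k.+1%:Z <= weight (residual p N) P).
have [/existsP[P0 /andP[sP0 qP0]]|/existsPn nt] := boolP [exists P, tight P]; last first.
  have [|N' [cN' HN']] := IHk N.
    by move=> P sP; have := nt P; rewrite /tight sP /=; clear; lia.
  by exists N'; split=> //; move: cN'; clear; lia.
pose q' j := q j + k.+1%:Z.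
have q'_spread : spreading q'.
  by move=> a b a' b' h1 h2; have := q_spread a b a' b' h1 h2; rewrite /q'; clear; lia.
(* If all members met [N], the residual weight would be [weight p P - #|P|], at most [q #|P|] by
   [le_q]. *)
have free P : subpart P -> q' #|P| <= weight (residual p N) P ->
    exists2 W, W \in P & [disjoint W & N].
  move=> sP qP; apply/exists_inP; apply: contraT => /exists_inPn hit.
  by have := weight_residual_hit p hit; have := le_q P sP; move: qP; rewrite /q'; clear; lia.
have [t Ht] := common_untouched (residual_super p_super) q'_spread leN free sP0 qP0.
have [|N' [cN' HN']] := IHk (t |: N).
  (* A tight family loses a unit at its [N]-avoiding member through [t]; any other had a unit to
     spare. *)
  move=> P sP; have [qP|nqP] := leP (q #|P| + k.+1%:Z) (weight (residual p N) P).
    have /exists_inP[W WP tW] := Ht P sP qP.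
    have := leN P sP; rewrite !(weight_setD1 _ WP).
    have := residual_setU1 p N t W; rewrite tW.
    have : weight (residual p (t |: N)) (P :\ W) <= weight (residual p N) (P :\ W).
      by apply: weight_le => V _; rewrite -(residual_setU1 p N t V); clear; lia.
    by clear; slia.
  have : weight (residual p (t |: N)) P <= weight (residual p N) P.
    by apply: weight_le => V _; rewrite -(residual_setU1 p N t V); clear; lia.
  by move: nqP; clear; lia.
exists N'; split=> //; move: cN'; rewrite cardsU1; case: (t \in N) => /=; clear; lia.
Qed.

(** A node [s] with at most [m s] neighbours meets at most [minn (m s) k] of [k] disjoint sets. *)
Definition capacity (S : finType) (D : {set S}) (m : S -> nat) (k : nat) : nat :=
  \sum_(s in D) minn (m s) k.

Lemma capacity_spreading (S : finType) (D : {set S}) (m : S -> nat) :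
  spreading (fun k => (capacity D m k)%:Z).
Proof.
move=> a b a' b' h1 h2; rewrite -!PoszD lez_nat /capacity -!big_split /=.
by apply: leq_sum => s _; lia.
Qed.

(** Induction on [D]: the summand of [s] in the capacity is the slack that [hitting_set] allows, and
    the residual goes to the other nodes. *)
Lemma cover_exists (S T : finType) (p : {set T} -> int) (m : S -> nat)
    (D : {set S}) :
    pos_intersecting_supermodular p ->
    (forall P, subpart P -> weight p P <= (capacity D m #|P|)%:Z) ->
  exists N : S -> {set T}, (forall s, #|N s| <= m s)%N /\
    forall Y, Y != set0 -> p Y <= #|[set s in D | ~~ [disjoint Y & N s]]|%:Z.
Proof.
have [k] := ubnP #|D|; elim: k D p => // k IHk D p leD p_super le_cap.
have [D0|[s sD]] := set_0Vmem D.
  exists (fun=> set0); split=> [s|Y Y0]; first by rewrite cards0.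
  have := le_cap [set Y]; rewrite /capacity D0 big_set0 /weight big_set1 => H.
  apply: le_trans (H _) _ => //; apply: subpartI => [A B x /set1P-> /set1P->//|A /set1P->].
  exact/set0Pn.
have [||N [cN HN]] := @hitting_set T p (fun k => (capacity (D :\ s) m k)%:Z) (m s) p_super.
- exact: capacity_spreading.
- move=> P sP; apply: le_trans (le_cap P sP) _.
  by rewrite /capacity (big_setD1 s sD) /= addnC PoszD.
have [|||M [cM HM]] := IHk (D :\ s) (residual p N).
- by move: leD; rewrite (cardsD1 s) sD.
- exact: residual_super.
- exact: HN.
exists (fun s' => if s' == s then N else M s'); split=> [s'|Y Y0].
  by case: eqP => [->|_].
have := HM Y Y0; rewrite /residual => le.
rewrite (cardsD1 s) !inE sD eqxx /=.
have -> : [set s' in D | ~~ [disjoint Y & if s' == s then N else M s']] :\ s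
          = [set s' in D :\ s | ~~ [disjoint Y & M s']].
  apply/setP => s'; rewrite !inE; case: eqP => //=.
by move: le; clear; lia.
Qed.

(** * Two-sided degree bounds *)

(** A lower bound on the degree of [t] becomes the demand of its singleton. The sum only reads off
    the value at the single element. *)
Definition raise (T : finType) (p : {set T} -> int) (h : T -> nat)
    (W : {set T}) : int :=
  if #|W| == 1%N then (\sum_(t in W) h t)%N%:Z else p W.

Lemma raise1 (T : finType) (p : {set T} -> int) (h : T -> nat) t :
  raise p h [set t] = (h t)%:Z.
Proof. by rewrite /raise cards1 big_set1. Qed.

Lemma raise_ge (T : finType) (p : {set T} -> int) (h : T -> nat) W :
  (forall t, p [set t] <= (h t)%:Z) -> p W <= raise p h W.
Proof.
by move=> ph; rewrite /raise; case: cards1P => // -[t ->]; rewrite big_set1.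
Qed.

(** If [X] or [Y] is a singleton, meeting means containment and equality holds. Otherwise both keep
    their values and the right side can only grow. *)
Lemma raise_super (T : finType) (p : {set T} -> int) (h : T -> nat) :
    pos_intersecting_supermodular p -> (forall t, p [set t] <= (h t)%:Z) ->
  pos_intersecting_supermodular (raise p h).
Proof.
move=> p_super ph X Y mXY; have /set0Pn[x /setIP[xX xY]] := mXY.
have [/cards1P[t tX]|X1] := boolP (#|X| == 1%N).
  have /setIidPl -> : X \subset Y by rewrite tX sub1set; move: xX xY; rewrite tX => /set1P->.
  suff /setUidPr -> : X \subset Y by [].
  by rewrite tX sub1set; move: xX xY; rewrite tX => /set1P->.
have [/cards1P[t tY]|Y1] := boolP (#|Y| == 1%N).
  have sYX : Y \subset X by rewrite tY sub1set; move: xY xX; rewrite tY => /set1P->.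
  by rewrite (setIidPr sYX) (setUidPl sYX) addrC.
rewrite {1 2 3 4}/raise (negPf X1) (negPf Y1) => pX pY.
apply: le_trans (p_super X Y mXY pX pY) _.
by apply: lerD; apply: raise_ge.
Qed.

Lemma weight_raise (T : finType) (p : {set T} -> int) (g h : T -> nat)
    (P : {set {set T}}) :
  weight (raise p g) P =
  weight (raise p h) P + \sum_(t | [set t] \in P) ((g t)%:Z - (h t)%:Z).
Proof.
apply/eqP; rewrite addrC -subr_eq /weight -sumrB; apply/eqP.
rewrite (bigID (fun W : {set T} => #|W| == 1%N)) /= addrC big1 ?add0r; last first.
  by move=> W /andP[_ W1]; rewrite /raise (negPf W1) subrr.
rewrite (eq_bigl (fun W => W \in [set [set t] | t in [set t | [set t] \in P]])).
  rewrite big_imset /=; last by move=> x y _ _; apply: set1_inj.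
  by apply: eq_big => t; rewrite ?inE // !raise1.
move=> W; apply/andP/imsetP => [[WP /cards1P[t tW]]|[t]].
  by exists t; rewrite ?inE -?tW.
by rewrite inE => tP ->; rewrite cards1.
Qed.

Definition incr (I : finType) (m : I -> nat) (i : I) : I -> nat :=
  fun j => (m j + (j == i))%N.

Lemma maximal_between (I : finType) (f g : I -> nat) (C : (I -> nat) -> bool) :
    (forall i, f i <= g i)%N -> C f ->
  exists m, [/\ forall i, (f i <= m i <= g i)%N, C m &
    forall i, (m i < g i)%N -> ~~ C (incr m i)].
Proof.
have [n] := ubnP (\sum_i (g i - f i)); elim: n f => // n IHn f len le_fg Cf.
have [/existsP[i /andP[lt Ci]]|/existsPn nC] :=
  boolP [exists i, (f i < g i)%N && C (incr f i)]; last first.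
  exists f; split=> // [i|i lt]; first by rewrite leqnn le_fg.
  by have := nC i; rewrite lt.
have [| | |m [le_m Cm max_m]] := IHn (incr f i).
- rewrite -ltnS; apply: leq_trans len; rewrite ltnS.
  rewrite (bigD1 i) //= [leqRHS](bigD1 i) //= /incr eqxx.
  have : (\sum_(j | j != i) (g j - (f j + (j == i))) <= \sum_(j | j != i) (g j - f j))%N.
    by apply: leq_sum => j _; clear; lia.
  by move: lt; clear; lia.
- by move=> j; rewrite /incr; case: eqP => [->|_]; rewrite ?addn1 ?addn0.
- exact: Ci.
exists m; split=> // j; have := le_m j; rewrite /incr; clear; lia.
Qed.

Lemma leq_sum_tight (I : finType) (a b : I -> nat) :
    (forall i, a i <= b i)%N -> (\sum_i b i <= \sum_i a i)%N ->
  forall i, a i = b i.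
Proof.
move=> le_ab le_sum i; move: le_sum; rewrite [leqLHS](bigD1 i) //= [leqRHS](bigD1 i) //=.
have : (\sum_(j | j != i) a j <= \sum_(j | j != i) b j)%N by apply: leq_sum.
by have := le_ab i; clear; lia.
Qed.

Section BoundedDegrees.
Variables (S T : finType) (p : {set T} -> int).
Variables (fS gS : S -> nat) (fT gT : T -> nat).
Hypothesis p_super : pos_intersecting_supermodular p.
Hypothesis le_S : forall s, (fS s <= gS s)%N.
Hypothesis le_T : forall t, (fT t <= gT t)%N.
Hypothesis p1 : forall t, p [set t] <= (fT t)%:Z.
Implicit Types (P Q : {set {set T}}) (m : S -> nat).

Let cap m k := (capacity [set: S] m k)%:Z.
Let excess m k := (\sum_s (m s - k))%N%:Z.

Lemma cap_excess m k : cap m k + excess m k = (\sum_s m s)%N%:Z.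
Proof.
rewrite /cap /excess /capacity -PoszD; congr Posz.
rewrite (eq_bigl predT) => [|s]; last by rewrite inE.
by rewrite -big_split; apply: eq_bigr => s _ /=; lia.
Qed.

(** Conditions (1) and (2) optimised over [X]: [cap] is the minimum of [|X| k + g(S - X)], [excess]
    the maximum of [f(X) - |X| k]. Singletons in [P] stand for points of [Y]. *)
Hypothesis lower : forall P, subpart P -> weight (raise p fT) P <= cap gS #|P|.
Hypothesis upper : forall P, subpart P ->
  weight (raise p gT) P + excess fS #|P| <= (\sum_t gT t)%N%:Z.

Lemma choose_S_degrees : exists m,
  [/\ forall s, (fS s <= m s <= gS s)%N,
      forall P, subpart P -> weight (raise p fT) P <= cap m #|P|
    & forall P, subpart P ->
        weight (raise p gT) P + excess m #|P| <= (\sum_t gT t)%N%:Z].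
Proof.
pose C m := [forall P, subpart P ==>
  (weight (raise p gT) P + excess m #|P| <= (\sum_t gT t)%N%:Z)].
have [|m [le_m /forallP Cm max_m]] := maximal_between le_S (C := C).
  by apply/forallP => P; apply/implyP; apply: upper.
have {}Cm P : subpart P -> weight (raise p gT) P + excess m #|P| <= (\sum_t gT t)%N%:Z.
  exact/implyP/Cm.
exists m; split=> // P sP; have [k leP] := ubnP #|P|.
elim: k P leP sP => // k IHk P leP sP; rewrite leNgt; apply/negP => viol.
(* [gS] obeys the bound that [m] violates, so some summand [minn (m s) #|P|] can still grow. *)
have [s [lt_s lt_P]] : exists s, (m s < gS s)%N /\ (m s < #|P|)%N.
  have [/existsP[s /andP[]]|/existsPn none] :=
      boolP [exists s, (m s < gS s)%N && (m s < #|P|)%N]; first by exists s.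
  have := lower sP; rewrite leNgt => /negP[]; apply: le_lt_trans viol.
  rewrite lez_nat /capacity; apply: leq_sum => s _.
  by have := none s; clear; lia.
have := max_m s lt_s; rewrite negb_forall => /existsP[Q].
rewrite negb_imply -ltNge => /andP[sQ violQ].
have excess_incr k' : excess (incr m s) k' = excess m k' + (k' <= m s)%N%:Z.
  rewrite /excess (bigD1 s) //= [in RHS](bigD1 s) //= /incr eqxx.
  rewrite (eq_bigr (fun i => m i - k')%N) => [|i /negPf ->]; last by rewrite addn0.
  by case: (leqP k' (m s)); lia.
have := Cm Q sQ; move: violQ; rewrite excess_incr => violQ CmQ.
(* Raising [m s] affects the excess at [#|Q|] only in this case; so [Q] is smaller than [P], and
   tight for [m]. *)
have le_Q : (#|Q| <= m s)%N by move: violQ CmQ; case: leqP => // _; clear; lia.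
have [Pl [Pu [/andP[sl su] w_lu /andP[c_u c_lu] singl]]] :=
  uncross_pair (raise_super p_super p1) sP sQ.
(* Passing from [fT] to [gT] raises only singletons, and those of [Q] all occur in [Pl]. *)
have gain : weight (raise p gT) Q - weight (raise p fT) Q
              <= weight (raise p gT) Pl - weight (raise p fT) Pl.
  rewrite !(weight_raise p gT fT) !(addrC (weight _ _)) !addrK.
  rewrite big_mkcond [leRHS]big_mkcond /=; apply: ler_sum => t _.
  have := singl t; have := le_T t; case: (_ \in Q) => [|_ _]; last first.
    by case: ifP => // _; rewrite subr_ge0 lez_nat.
  by rewrite orbT => _ ->.
(* [Pu] is smaller than [P] and obeys the lower bound, [Pl] obeys the upper one; with concavity this
   contradicts the violations by [P] and [Q]. *)
have spread := capacity_spreading [set: S] m c_u c_lu.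
have IHu : weight (raise p fT) Pu <= cap m #|Pu|.
  by apply: IHk => //; move: c_u leP lt_P le_Q; clear; lia.
have Cl := Cm Pl sl.
have e1 := cap_excess m #|Pl|; have e2 := cap_excess m #|Q|.
move: viol violQ w_lu gain IHu Cl e1 e2 spread; rewrite le_Q -/(cap m _).
rewrite -!/(cap m _).
move: (\sum_s m s)%N (\sum_t gT t)%N => M G.
move: (cap m #|Pl|) (cap m #|Pu|) (cap m #|P|) (cap m #|Q|).
move: (excess m #|Pl|) (excess m #|Q|).
move: (weight (raise p gT) Pl) (weight (raise p gT) Q).
move: (weight (raise p fT) Pl) (weight (raise p fT) Pu).
move: (weight (raise p fT) P) (weight (raise p fT) Q).
clear; lia.
Qed.

(** By maximality, each [t] with [h t < gT t] has its singleton in a tight family. Uncrossing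
    gathers these singletons in one tight family, whose upper bound compares the totals. *)
Lemma choose_T_degrees m :
    (forall P, subpart P -> weight (raise p fT) P <= cap m #|P|) ->
    (forall P, subpart P ->
       weight (raise p gT) P + excess m #|P| <= (\sum_t gT t)%N%:Z) ->
  exists h : T -> nat, [/\ forall t, (fT t <= h t <= gT t)%N,
    forall P, subpart P -> weight (raise p h) P <= cap m #|P|
    & (\sum_s m s <= \sum_t h t)%N].
Proof.
move=> lower_m upper_m.
pose C (h : T -> nat) := [forall P, subpart P ==> (weight (raise p h) P <= cap m #|P|)].
have [|h [le_h /forallP Ch max_h]] := maximal_between le_T (C := C).
  by apply/forallP => P; apply/implyP; apply: lower_m.
have {}Ch P : subpart P -> weight (raise p h) P <= cap m #|P| by apply/implyP/Ch.
exists h; split=> //.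
have ph t : p [set t] <= (h t)%:Z.
  by apply: le_trans (p1 t) _; rewrite lez_nat; case/andP: (le_h t).
have tight1 t : (h t < gT t)%N -> exists P, [/\ subpart P,
    cap m #|P| <= weight (raise p h) P & [set t] \in P].
  move/max_h; rewrite negb_forall => /existsP[P]; rewrite negb_imply -ltNge.
  case/andP=> sP; rewrite (weight_raise p (incr h t) h) => viol; exists P.
  have := Ch P sP; move: viol; have [tP|tP] := boolP ([set t] \in P).
    rewrite (bigD1 t) //= big1 => [|t' /andP[_ /negPf nt]]; last first.
      by rewrite /incr nt addn0 subrr.
    by rewrite /incr eqxx addr0 => viol _; split=> //; move: viol; clear; lia.
  rewrite big1 => [|t' t'P]; first by clear; lia.
  by rewrite /incr; case: eqP t'P tP => [->->|]; rewrite // addn0 subrr.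
have [P [sP tightP hP]] : exists P, [/\ subpart P,
    cap m #|P| <= weight (raise p h) P
    & forall t, t \in enum T -> (h t < gT t)%N -> [set t] \in P].
  elim: (enum T) => [|t l [P [sP tP hP]]].
    exists set0; split=> //; first by apply: subpartI => ?; rewrite inE.
    by rewrite weight0 cards0 lez_nat leqn0 /capacity; apply/eqP/big1 => s _; rewrite minn0.
  have [/tight1[Q [sQ tQ tt]]|le_t] := ltnP (h t) (gT t); last first.
    exists P; split=> // t'; rewrite inE => /orP[/eqP->|/hP//].
    by rewrite ltnNge le_t.
  have [Pl [Pu [/andP[sl su] w_lu /andP[c_u c_lu] singl]]] :=
    uncross_pair (raise_super p_super ph) sP sQ.
  exists Pl; split=> // [|t']; last first.
    rewrite inE => /orP[/eqP-> _|t'l lt]; apply: singl; first by rewrite tt orbT.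
    by rewrite hP.
  have := capacity_spreading [set: S] m c_u c_lu; rewrite -!/(cap m _).
  by have := Ch Pu su; move: w_lu tP tQ; clear; lia.
have := upper_m P sP; rewrite (weight_raise p gT h).
(* Where the singleton is not in [P], [h] equals [gT]. *)
have -> : \sum_(t | [set t] \in P) ((gT t)%:Z - (h t)%:Z)
          = (\sum_t gT t)%N%:Z - (\sum_t h t)%N%:Z.
  rewrite -!natz !natr_sum -sumrB [in RHS](bigID (fun t => [set t] \in P)) /=.
  rewrite [X in _ + X]big1 ?addr0 => [|t ntP].
    by apply: eq_bigr => t _; rewrite !natz.
  apply/eqP; rewrite subr_eq0 !natz eqz_nat eqn_leq.
  have /andP[_ ->] := le_h t; rewrite andbT leqNgt.
  by apply: contra ntP; apply: hP; rewrite mem_enum.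
have := cap_excess m #|P|; move: tightP; clear; lia.
Qed.

(** The node degrees are at most [m] on [S] and at least [h] on [T]. Both sides have the same degree
    sum and [m] has no larger total than [h], so equality holds at every node. *)
Lemma bounded_degree_cover : exists N : S -> {set T},
  [/\ forall Y, Y != set0 -> p Y <= #|[set s | ~~ [disjoint Y & N s]]|%:Z,
      forall s, (fS s <= #|N s| <= gS s)%N
    & forall t, (fT t <= #|[set s | t \in N s]| <= gT t)%N].
Proof.
have [m [le_m lower_m upper_m]] := choose_S_degrees.
have [h [le_h cap_h sum_h]] := choose_T_degrees lower_m upper_m.
have ph t : p [set t] <= (h t)%:Z.
  by apply: le_trans (p1 t) _; rewrite lez_nat; case/andP: (le_h t).
have [N [N_le N_cov]] := cover_exists (raise_super p_super ph) cap_h.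
have setTE (D : pred S) : [set s in [set: S] | D s] = [set s | D s].
  by apply/setP => s; rewrite !inE.
have h_le t : (h t <= #|[set s | t \in N s]|)%N.
  rewrite -lez_nat -(raise1 p h).
  have := N_cov [set t]; rewrite setTE.
  rewrite -(_ : #|[set s | ~~ [disjoint [set t] & N s]]| = #|[set s | t \in N s]|).
    by apply; apply/set0Pn; exists t; rewrite inE.
  by apply: eq_card => s; rewrite !inE disjoints1 negbK.
have double : (\sum_t #|[set s | t \in N s]| = \sum_s #|N s|)%N.
  rewrite (eq_bigr (fun t => \sum_s (t \in N s : nat))%N) => [|t _].
    rewrite exchange_big; apply: eq_bigr => s _ /=.
    by rewrite -sum1_card [RHS]big_mkcond /=; apply: eq_bigr => t _; case: (_ \in _).
  by rewrite -sum1_card big_mkcond /=; apply: eq_bigr => s _; rewrite inE; case: (_ \in _).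
have le1 : (\sum_s #|N s| <= \sum_s m s)%N by apply: leq_sum.
have le2 : (\sum_t h t <= \sum_t #|[set s | t \in N s]|)%N by apply: leq_sum.
have Ns := leq_sum_tight N_le; have Nt := leq_sum_tight h_le.
exists N; split=> [Y Y0|s|t].
- by rewrite -setTE; apply: le_trans (N_cov Y Y0); apply: raise_ge.
- by rewrite Ns; first exact: le_m; apply: leq_trans sum_h _; rewrite -double.
- by rewrite -Nt; first exact: le_h; rewrite double; apply: leq_trans sum_h.
Qed.

End BoundedDegrees.

(** * The conditions (1) and (2) *)

Lemma leq_card_meet (T : finType) (P : {set {set T}}) (A : {set T}) :
  subpart P -> (forall W, W \in P -> W :&: A != set0) -> (#|P| <= #|A|)%N.
Proof.
move=> sP meetA; pose rep (W : {set T}) := [pick x in W :&: A].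
have repE W : W \in P -> exists x, rep W = Some x /\ x \in W :&: A.
  move=> /meetA/set0Pn[y yW]; rewrite /rep; case: pickP => [x xW|/(_ y)].
    by exists x.
  by rewrite yW.
have rep_inj : {in P &, injective rep}.
  move=> V W VP WP E; have [x [Vx /setIP[xV _]]] := repE V VP.
  have [y [Wy /setIP[yW _]]] := repE W WP; move: E; rewrite Vx Wy => -[xy].
  by apply: subpart_disjoint sP VP WP xV _; rewrite xy.
rewrite -(card_in_imset rep_inj).
have <- : #|[set Some x | x in A]| = #|A| by apply: card_imset => x y [].
apply/subset_leq_card/subsetP => o /imsetP[W /repE[x [-> /setIP[_ xA]]] ->].
exact: imset_f.
Qed.

Lemma subpartitionP (T : finType) (P : {set {set T}}) (A : {set T}) :
  subpartition P A <-> subpart P /\ cover P \subset A.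
Proof.
by split=> [[tP P0 sP]|[/andP[tP P0] sP]]; split=> //; apply/andP.
Qed.

Lemma subpartition0 (T : finType) (A : {set T}) : subpartition set0 A.
Proof.
apply/subpartitionP; split; last by rewrite /cover big_set0 sub0set.
by apply: subpartI => ?; rewrite inE.
Qed.

Section Bounds.
Variables (V : finType) (h : V -> \bar int) (a : V -> nat) (X : {set V}).

Lemma tilde_nat : (forall v, v \in X -> h v = (a v)%:Z%:E) ->
  tilde h X = ((\sum_(v in X) a v)%N%:Z)%:E.
Proof.
move=> hE; rewrite /tilde (eq_bigr (fun v => (a v)%:Z%:E)) // sumEFin.
by rewrite -natz natr_sum; congr EFin; apply: eq_bigr => v _; rewrite natz.
Qed.

Lemma tilde_le_nat : (forall v, v \in X -> (h v <= (a v)%:Z%:E)%E) ->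
  (tilde h X <= ((\sum_(v in X) a v)%N%:Z)%:E)%E.
Proof.
move=> le_h; apply: (@le_trans _ _ (\sum_(v in X) (a v)%:Z%:E)%E).
  exact: lee_sum.
rewrite sumEFin lee_fin -[leRHS]natz natr_sum.
by apply: ler_sum => v _; rewrite natz.
Qed.

Lemma nat_le_tilde : (forall v, v \in X -> ((a v)%:Z%:E <= h v)%E) ->
  (((\sum_(v in X) a v)%N%:Z)%:E <= tilde h X)%E.
Proof.
move=> le_h; apply: (@le_trans _ _ (\sum_(v in X) (a v)%:Z%:E)%E).
  rewrite sumEFin lee_fin -[leLHS]natz natr_sum.
  by apply: ler_sum => v _; rewrite natz.
exact: lee_sum.
Qed.

End Bounds.

Lemma gather (x : \bar int) (a b c : int) :
  (x - a%:E + b%:E - c%:E = x + (b - a - c)%:E)%E.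
Proof.
case: x => [r| |] //=.
by congr EFin; lia.
Qed.

Section Conditions.
Variables (S T : finType) (f g : S + T -> \bar int) (p : {set T} -> int).
Implicit Types (X : {set S}) (Y : {set T}) (P Q : {set {set T}}).

Lemma conditions_le X Y P Q :
    weight p P - (#|P| * #|X|)%N%:Z <= weight p Q - (#|Q| * #|X|)%N%:Z ->
    condition1 f g p X Y Q /\ condition2 f g p X Y Q ->
  condition1 f g p X Y P /\ condition2 f g p X Y P.
Proof.
rewrite /condition1 /condition2 !gather -!/(weight _ _) => le [c1 c2].
by split; [apply: le_trans c1|apply: le_trans c2]; apply: leeD2l;
  rewrite lee_fin; move: le; clear; lia.
Qed.

(** With [p set0 = 0], supermodularity gives superadditivity on disjoint sets. *)
Lemma weight_le_cover P : fully_supermodular p -> p set0 = 0 -> subpart P ->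
  weight p P <= p (cover P).
Proof.
move=> p_full p0; have [k] := ubnP #|P|; elim: k P => // k IHk P leP sP.
have [->|[W WP]] := set_0Vmem P; first by rewrite weight0 /cover big_set0 p0.
have sD : P :\ W \subset P by apply: subsetDl.
rewrite (weight_setD1 _ WP) /cover (big_setD1 W) //= -/(cover _).
have := IHk (P :\ W); have -> : (#|P :\ W| < k)%N by move: leP; rewrite (cardsD1 W) WP.
move=> /(_ isT (subpartS sD sP)).
have := p_full W (cover (P :\ W)).
have -> : W :&: cover (P :\ W) = set0.
  apply/setP => x; rewrite !inE; apply/negP => /andP[xW /bigcupP[Z]].
  move=> /setD1P[nZW ZP] xZ.
  by rewrite (subpart_disjoint sP ZP WP xZ xW) eqxx in nZW.
by rewrite p0; clear; slia.
Qed.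

End Conditions.

(** * Necessity of the conditions *)

Definition neighbours (S T : finType) (E : {set S * T}) (s : S) : {set T} :=
  [set t | (s, t) \in E].

Lemma deg_inl (S T : finType) (E : {set S * T}) s :
  deg E (inl s) = #|neighbours E s|.
Proof.
rewrite /= -(card_imset (neighbours E s) (_ : injective (pair s))).
  apply: eq_card => -[s' t]; rewrite !inE /=.
  apply/andP/imsetP => [[sE /eqP s's]|[t' t'N [-> ->]]].
    by exists t; rewrite ?inE -s's.
  by rewrite eqxx; rewrite inE in t'N.
by move=> t t' [].
Qed.

Lemma deg_inr (S T : finType) (E : {set S * T}) t :
  deg E (inr t) = #|[set s | t \in neighbours E s]|.
Proof.
rewrite /= -(card_imset [set s | t \in neighbours E s] (_ : injective (pair^~ t))).
  apply: eq_card => -[s t']; rewrite !inE /=.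
  apply/andP/imsetP => [[sE /eqP t't]|[s' s'N [-> ->]]].
    by exists s; rewrite ?inE -t't.
  by rewrite eqxx; rewrite !inE in s'N.
by move=> s s' [].
Qed.

Lemma GammaE (S T : finType) (E : {set S * T}) (Y : {set T}) :
  Gamma E Y = [set s | ~~ [disjoint Y & neighbours E s]].
Proof.
apply/setP => s; rewrite !inE -setI_eq0; apply/exists_inP/set0Pn => -[t].
  by move=> tY tE; exists t; rewrite !inE tY.
by rewrite !inE => /andP[tY tE]; exists t.
Qed.

Lemma card_exchange (S T : finType) (D : {set T}) (R : S -> T -> bool) :
  (\sum_(t in D) #|[set s | R s t]| = \sum_s #|[set t in D | R s t]|)%N.
Proof.
rewrite (eq_bigr (fun t => \sum_s (R s t : nat))%N) => [|t _].
  rewrite exchange_big; apply: eq_bigr => s _ /=.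
  rewrite -sum1_card big_mkcond [RHS]big_mkcond /=; apply: eq_bigr => t _.
  by rewrite inE; case: (t \in D) => //; case: R.
by rewrite -sum1_card big_mkcond /=; apply: eq_bigr => s _; rewrite inE; case: R.
Qed.

Section Necessity.
Variables (S T : finType) (E : {set S * T}) (p : {set T} -> int).
Hypothesis cov : covers E p.

Lemma edge_bound (X : {set S}) (Y : {set T}) (P : {set {set T}}) :
    subpart P -> cover P \subset ~: Y ->
  (\sum_(t in Y) deg E (inr t))%N%:Z + weight p P
    <= (#|X| * (#|Y| + #|P|) + \sum_(s in ~: X) deg E (inl s))%N%:Z.
Proof.
move=> sP sPY; pose hit s := [set W in P | ~~ [disjoint W & neighbours E s]].
have le_p : weight p P <= (\sum_s #|hit s|)%N%:Z.
  rewrite -card_exchange -[leRHS]natz natr_sum; apply: ler_sum => W _.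
  by rewrite natz -GammaE; apply: cov.
have degY : (\sum_(t in Y) deg E (inr t) = \sum_s #|Y :&: neighbours E s|)%N.
  rewrite (eq_bigr _ (fun t _ => deg_inr E t)) card_exchange.
  by apply: eq_bigr => s _; apply: eq_card => t; rewrite !inE.
rewrite degY (eq_bigr _ (fun s _ => deg_inl E s)); apply: le_trans (lerD (lexx _) le_p) _.
rewrite -PoszD lez_nat -big_split /= (bigID (mem X)) /=.
apply: leq_add.
  rewrite -sum_nat_const; apply: leq_sum => s _; apply: leq_add.
    exact: subset_leq_card (subsetIl _ _).
  by apply: subset_leq_card; apply/subsetP => W /setIdP[].
rewrite [leqRHS](eq_bigl (fun s => s \notin X)) => [|s]; last by rewrite inE.
apply: leq_sum => s _; rewrite -(cardsID Y (neighbours E s)) setIC.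
rewrite leq_add2l; apply: leq_card_meet.
  by apply: subpartS sP; apply/subsetP => W /setIdP[].
move=> W /setIdP[WP]; rewrite -setI_eq0 => /set0Pn[x /setIP[xW xN]].
apply/set0Pn; exists x; rewrite inE xW inE xN andbT.
have /subsetP/(_ x) := sPY; rewrite inE; apply; apply/bigcupP; by exists W.
Qed.

Lemma conditions_necessary (f g : S + T -> \bar int) X Y P :
    degree_bounded E f g -> subpartition P (~: Y) ->
  condition1 f g p X Y P /\ condition2 f g p X Y P.
Proof.
move=> bnd /subpartitionP[sP sPY]; have key := edge_bound X sP sPY.
have le_f v : (f v <= (deg E v)%:Z%:E)%E by case/andP: (bnd v).
have le_g v : ((deg E v)%:Z%:E <= g v)%E by case/andP: (bnd v).
rewrite /condition1 /condition2 !gather -!/(weight _ _); split.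
  apply: le_trans (nat_le_tilde (a := fun s => deg E (inl s)) (fun s _ => le_g _)).
  have leT := tilde_le_nat (a := fun t => deg E (inr t)) (fun t _ => le_f _).
  apply: le_trans (leeD2r _ (leT Y)) _.
  by rewrite -EFinD lee_fin; move: key; rewrite mulnDr; clear; lia.
apply: le_trans (nat_le_tilde (a := fun t => deg E (inr t)) (fun t _ => le_g _)).
apply: le_trans (leeD2r _ (tilde_le_nat (a := fun s => deg E (inl s)) (fun s _ => le_f _))) _.
(* Equality of the two degree sums turns [edge_bound] into (2). *)
have total : (\sum_(s in X) deg E (inl s) + \sum_(s in ~: X) deg E (inl s)
    = \sum_(t in Y) deg E (inr t) + \sum_(t in ~: Y) deg E (inr t))%N.
  have sumC (I : finType) (A : {set I}) (F : I -> nat) :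
      (\sum_(i in A) F i + \sum_(i in ~: A) F i = \sum_i F i)%N.
    rewrite [RHS](bigID (mem A)) /=; congr addn.
    by apply: eq_bigl => i; rewrite inE.
  rewrite !sumC (eq_bigr _ (fun t _ => deg_inr E t)) (eq_bigr _ (fun s _ => deg_inl E s)).
  transitivity (\sum_(t in [set: T]) #|[set s | t \in neighbours E s]|)%N.
    rewrite card_exchange; apply: eq_bigr => s _; apply: eq_card => t.
    by rewrite !inE.
  by apply: eq_bigl => t; rewrite inE.
rewrite -EFinD lee_fin; move: key total; rewrite mulnDr; clear; lia.
Qed.

End Necessity.

(** * Truncated bounds and sufficiency *)

Definition lo (x : \bar int) : nat := if x is (Posz k)%:E then k else 0.
(** Negative arguments also give [B]; the bounds it is applied to are shown to be nonnegative. *)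
Definition hi (B : nat) (x : \bar int) : nat :=
  if x is (Posz k)%:E then minn k B else B.

Lemma lo_ge x : x <> +oo%E -> (x <= (lo x)%:Z%:E)%E.
Proof. by case: x => [[k|k]| |] //. Qed.

Lemma loE x : (0 < lo x)%N -> x = (lo x)%:Z%:E.
Proof. by case: x => [[k|k]| |]. Qed.

Lemma hi_le B x : (0 <= x)%E -> ((hi B x)%:Z%:E <= x)%E.
Proof.
by case: x => [[k|k]| |] //= _; rewrite ?leey // lee_fin lez_nat geq_minl.
Qed.

Lemma hiE B x : (0 <= x)%E -> (x <= B%:Z%:E)%E -> x = (hi B x)%:Z%:E.
Proof.
by case: x => [[k|k]| |] //= _; rewrite lee_fin lez_nat => /minn_idPl->.
Qed.

Lemma hi_big B k x : (k%:Z%:E <= x)%E -> (k <= B)%N -> (k <= hi B x)%N.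
Proof.
case: x => [[j|j]| |] //=; rewrite lee_fin // lez_nat => kj kB.
by rewrite leq_min kj.
Qed.

Lemma hi_bound B x : (hi B x <= B)%N.
Proof. by case: x => [[k|k]| |] //=; rewrite geq_minr. Qed.

Lemma lo_le_hi B x y :
  (x <= y)%E -> (0 <= y)%E -> (lo x <= B)%N -> (lo x <= hi B y)%N.
Proof.
case: x => [[k|k]| |] //= xy y0 kB; exact: hi_big.
Qed.

(** Translates a raised family into the [Y] and subpartition of (1) and (2). *)
Lemma weight_raise_split (T : finType) (p : {set T} -> int) (h : T -> nat)
    (P : {set {set T}}) (Y : {set T}) :
    subpart P -> (forall t, t \in Y -> [set t] \in P) ->
    (forall t, [set t] \in P -> t \notin Y -> (h t)%:Z = p [set t]) ->
  exists P2, [/\ subpart P2, cover P2 \subset ~: Y,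
    weight (raise p h) P = (\sum_(t in Y) h t)%N%:Z + weight p P2
    & #|P| = (#|Y| + #|P2|)%N].
Proof.
move=> sP YP hp; pose Q := [set [set t] | t in Y].
have sQ : Q \subset P by apply/subsetP => W /imsetP[t /YP tP ->].
exists (P :\: Q); split.
- exact: subpartS (subsetDl _ _) sP.
- apply/subsetP => x /bigcupP[W /setDP[WP WQ] xW]; rewrite inE.
  apply: contra WQ => xY; apply/imsetP; exists x => //.
  exact: subpart_disjoint sP WP (YP x xY) xW (set11 x).
- rewrite (weight_setD _ sQ) addrC; congr +%R.
    rewrite /weight big_imset /=; last by move=> x y _ _; apply: set1_inj.
    rewrite -[RHS]natz natr_sum; apply: eq_bigr => t _.
    by rewrite raise1 natz.
  apply: eq_bigr => W /setDP[WP WQ]; rewrite /raise.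
  case: cards1P => // -[t Wt]; rewrite Wt big_set1 hp -?Wt //.
  by apply: contra WQ => tY; apply/imsetP; exists t.
- rewrite cardsD (setIidPr sQ) card_imset ?subnKC //; last exact: set1_inj.
  by rewrite -(card_imset (mem Y) (@set1_inj T)); apply: subset_leq_card.
Qed.

Section Sufficiency.
Variables (S T : finType) (f g : S + T -> \bar int) (p : {set T} -> int).
Hypothesis f_neq_pinfty : forall v, f v <> +oo%E.
Hypothesis le_f_g : forall v, (f v <= g v)%E.
Hypothesis p_super : pos_intersecting_supermodular p.
Hypothesis p_set0 : p set0 = 0.
Hypothesis p_le_S : forall Y, p Y <= #|S|%:Z.
Hypothesis cond : forall (Y : {set T}) (X : {set S}) (P : {set {set T}}),
  subpartition P (~: Y) -> condition1 f g p X Y P /\ condition2 f g p X Y P.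

Let loS s := lo (f (inl s)).
Let loT t := lo (f (inr t)).
Let hiS s := hi #|T| (g (inl s)).
Let hiT t := hi #|S| (g (inr t)).

(** Condition (1) with [Y] empty and [X] omitting only [s]. *)
Lemma gS_ge0 s : (0 <= g (inl s))%E.
Proof.
have [] := cond (~: [set s]) (subpartition0 (~: set0)); rewrite /condition1.
rewrite gather /tilde big_set0 setCK !big_set1 /= big_set0 !cards0 muln0 mul0n.
by rewrite add0e.
Qed.

Lemma gT_ge0 t : (0 <= g (inr t))%E.
Proof.
have [_] := cond set0 (subpartition0 (~: ~: [set t])); rewrite /condition2.
rewrite gather /tilde big_set0 setCK !big_set1 /= big_set0 !cards0 muln0 mul0n.
by rewrite add0e.
Qed.

(** Condition (2) with [X = [set s]] and [Y = T]. *)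
Lemma loS_le s : (loS s <= #|T|)%N.
Proof.
have [loS0|] := posnP (loS s); first by rewrite loS0.
move/loE => fE; have [_] := cond [set s] (subpartition0 (~: setT)).
rewrite /condition2 gather /tilde setCT big_set0 big_set1 fE -/(loS s).
rewrite big_set0 cards0 cards1 cardsT mul1n mul0n -EFinD lee_fin; lia.
Qed.

Lemma loT_le t : (loT t <= #|S|)%N.
Proof.
have [loT0|] := posnP (loT t); first by rewrite loT0.
move/loE => fE; have [+ _] := cond setT (subpartition0 (~: [set t])).
rewrite /condition1 gather /tilde setCT big_set0 big_set1 fE -/(loT t).
rewrite big_set0 cards0 cards1 cardsT muln1 mul0n -EFinD lee_fin; lia.
Qed.

(** Condition (1) at its sharpest [X], the nodes with upper bound at least [k]. *)
Lemma lower_condition (Y : {set T}) (P : {set {set T}}) :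
    subpart P -> cover P \subset ~: Y ->
  (\sum_(t in Y) loT t)%N%:Z + weight p P
    <= (capacity [set: S] hiS (#|Y| + #|P|))%:Z.
Proof.
move=> sP sPY; pose k := (#|Y| + #|P|)%N.
(* Hence truncating at [#|T|] does not change a minimum with [k]. *)
have kT : (k <= #|T|)%N.
  rewrite -(cardsC Y) leq_add2l; apply: leq_card_meet => // W WP.
  have [x xW] := subpart_neq0 sP WP; apply/set0Pn; exists x; rewrite inE xW.
  by apply: (subsetP sPY); apply/bigcupP; exists W.
pose X := [set s | (k%:Z%:E <= g (inl s))%E].
pose Y' := [set t in Y | (0 < loT t)%N].
have sY' : Y' \subset Y by apply/subsetP => t /setIdP[].
have sub : subpartition P (~: Y').
  by apply/subpartitionP; split=> //; apply: subset_trans sPY _; rewrite setCS.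
have [+ _] := cond X sub; rewrite /condition1 gather -/(weight _ _).
rewrite (tilde_nat (a := loT)) => [|t /setIdP[_]]; last exact: loE.
rewrite (tilde_nat (a := hiS)) => [|s]; last first.
  rewrite !inE -ltNge => lt; apply: hiE; first exact: gS_ge0.
  by apply: le_trans (ltW lt) _; rewrite lee_fin lez_nat.
rewrite -EFinD lee_fin.
have -> : (\sum_(t in Y) loT t = \sum_(t in Y') loT t)%N.
  rewrite big_mkcond [RHS]big_mkcond /=; apply: eq_bigr => t _.
  by rewrite inE; case: (t \in Y); case: posnP.
have -> : capacity [set: S] hiS k = (#|X| * k + \sum_(s in ~: X) hiS s)%N.
  rewrite /capacity (bigID (mem X)) /=; congr addn.
    rewrite -sum_nat_const; apply: eq_big => s; rewrite !inE //= => sX.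
    by apply/minn_idPr; apply: hi_big.
  apply: eq_big => s; rewrite !inE //= -ltNge => lt; apply/minn_idPl.
  have : (g (inl s) <= k%:Z%:E)%E by apply: ltW.
  rewrite (hiE (gS_ge0 s) (_ : g (inl s) <= #|T|%:Z%:E)%E) ?lee_fin ?lez_nat //.
  by apply: le_trans (ltW lt) _; rewrite lee_fin lez_nat.
have : (#|X| * #|Y'| <= #|X| * #|Y|)%N by rewrite leq_mul2l subset_leq_card ?orbT.
by rewrite /k mulnDr [(#|P| * _)%N]mulnC; clear; lia.
Qed.

(** Condition (2) at its sharpest [X], the nodes with lower bound above [k]. *)
Lemma upper_condition (Y : {set T}) (P : {set {set T}}) :
    subpart P -> cover P \subset ~: Y ->
  weight p P + (\sum_s (loS s - (#|Y| + #|P|)))%N%:Z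
    <= (\sum_(t in ~: Y) hiT t)%N%:Z.
Proof.
move=> sP sPY; pose k := (#|Y| + #|P|)%N.
pose X := [set s | (k < loS s)%N].
pose Y0 := [set t in ~: Y | (#|S|%:Z%:E < g (inr t))%E].
(* Nodes with g > |S| may be moved to Y at the price of the members of P that
   they meet; this is where p <= |S| is used. *)
pose P3 := [set W in P | W :&: Y0 != set0].
have sP3 : P3 \subset P by apply/subsetP => W /setIdP[].
have sub : subpartition (P :\: P3) (~: (Y :|: Y0)).
  apply/subpartitionP; split; first exact: subpartS (subsetDl _ _) sP.
  apply/subsetP => x /bigcupP[W /setDP[WP W3] xW]; rewrite setCU.
  apply/setIP; split; first by apply: (subsetP sPY); apply/bigcupP; exists W.
  rewrite in_setC; apply: contra W3 => xY0; rewrite inE WP.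
  by apply/set0Pn; exists x; apply/setIP.
have [_] := cond X sub; rewrite /condition2 gather -/(weight _ _).
rewrite (tilde_nat (a := loS)) => [|s]; last first.
  by rewrite inE => lt; apply: loE; apply: leq_ltn_trans lt.
rewrite (tilde_nat (a := hiT)) => [|t]; last first.
  rewrite !inE negb_or => /andP[tY]; rewrite tY /= -leNgt.
  by apply: hiE; apply: gT_ge0.
rewrite -EFinD lee_fin.
have disY : [disjoint Y & Y0].
  by rewrite -setI_eq0; apply/eqP/setP => t; rewrite !inE; case: (t \in Y).
have cU : #|Y :|: Y0| = (#|Y| + #|Y0|)%N.
  by rewrite cardsU (eqP (_ : Y :&: Y0 == set0)) ?setI_eq0 // cards0 subn0.
have -> : (\sum_(t in ~: Y) hiT t = \sum_(t in ~: (Y :|: Y0)) hiT t + #|Y0| * #|S|)%N.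
  rewrite (bigID (mem Y0)) /= addnC; congr addn.
    by apply: eq_bigl => t; rewrite !inE negb_or.
  rewrite -sum_nat_const; apply: eq_big => t; rewrite !inE.
    by rewrite andbA andbb.
  case/andP=> _ /andP[_ lt]; apply/eqP; rewrite eqn_leq hi_bound.
  by apply: hi_big => //; apply: ltW.
have -> : (\sum_s (loS s - k) = \sum_(s in X) loS s - #|X| * k)%N.
  rewrite -sum_nat_const -sumnB => [|s]; last by rewrite inE => /ltnW.
  rewrite [RHS]big_mkcond /=; apply: eq_bigr => s _; rewrite inE.
  by case: ltnP => // /eqP.
have leX : (#|X| * k <= \sum_(s in X) loS s)%N.
  by rewrite -sum_nat_const; apply: leq_sum => s; rewrite inE => /ltnW.
have w3 : weight p P3 <= (#|P3| * #|S|)%N%:Z.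
  apply: le_trans (weight_le (h := fun=> #|S|%:Z) (fun W _ => p_le_S W)) _.
  by rewrite /weight sumr_const -mulr_natl natz PoszM.
have c3 : (#|P3| <= #|Y0|)%N.
  by apply: leq_card_meet (subpartS sP3 sP) _ => W /setIdP[].
have XS : (#|X| <= #|S|)%N by apply: max_card.
(* This is [(#|Y0| - #|P3|) * (#|S| - #|X|) >= 0]. *)
have key : (#|P3| * #|S| + #|Y0| * #|X| <= #|Y0| * #|S| + #|P3| * #|X|)%N.
  have [d dE] : exists d, #|Y0| = (#|P3| + d)%N by exists (#|Y0| - #|P3|)%N; lia.
  have := leq_mul (leqnn d) XS; rewrite dE !mulnDl; clear; lia.
have cP : #|P| = (#|P :\: P3| + #|P3|)%N.
  by rewrite cardsD (setIidPr sP3) subnK // subset_leq_card.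
rewrite (weight_setD p sP3) cU.
move: leX w3 key; rewrite /k cP; move: (#|P :\: P3|) => c.
rewrite !mulnDr !(mulnC #|X|) ?(mulnDl _ _ #|X|); clear; lia.
Qed.

Lemma conditions_sufficient :
  exists E : {set S * T}, covers E p /\ degree_bounded E f g.
Proof.
(* The larger of [loT t] and [p [set t]], since [raise] must not lower [p]. The absolute value
   occurs only for positive [p [set t]]. *)
pose fT t := if p [set t] <= (loT t)%:Z then loT t else `|p [set t]|%N.
have fTp t : p [set t] <= (fT t)%:Z.
  by rewrite /fT; case: ifP => //; lia.
have p_le_hi t : p [set t] <= (hiT t)%:Z.
  have s1 : subpart [set [set t]].
    apply: subpartI => [A B x /set1P-> /set1P->//|A /set1P->].
    by exists t; rewrite inE.
  have := @upper_condition (~: [set t]) [set [set t]] s1.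
  rewrite setCK /cover big_set1 subxx big_set1 /weight big_set1 => /(_ isT).
  lia.
have le_T t : (fT t <= hiT t)%N.
  rewrite /fT; case: leP => [_|lt]; last by have := p_le_hi t; move: lt; clear; lia.
  by apply: lo_le_hi (le_f_g _) (gT_ge0 t) (loT_le t).
have le_S s : (loS s <= hiS s)%N.
  exact: lo_le_hi (le_f_g _) (gS_ge0 s) (loS_le s).
have [||N [N_cov N_S N_T]] := bounded_degree_cover p_super le_S le_T fTp.
(* Singletons whose bound comes from [f] go to [Y]; the others weigh [p] and stay in the
   subpartition. *)
- move=> P sP; pose Y := [set t | ([set t] \in P) && (p [set t] <= (loT t)%:Z)].
  have [||P2 [s2 c2 -> ->]] := @weight_raise_split T p fT P Y sP.
  + by move=> t; rewrite inE => /andP[].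
  + move=> t tP; rewrite inE tP /= /fT => /negPf nle; rewrite nle.
    by move/negbT: nle; clear; lia.
  have := lower_condition s2 c2.
  suff -> : (\sum_(t in Y) fT t = \sum_(t in Y) loT t)%N by [].
  by apply: eq_bigr => t; rewrite inE /fT => /andP[_ ->].
- move=> P sP; pose Y := [set t | [set t] \in P].
  have [||P2 [s2 c2 -> ->]] := @weight_raise_split T p hiT P Y sP.
  + by move=> t; rewrite inE.
  + by move=> t tP; rewrite inE tP.
  have -> : (\sum_t hiT t = \sum_(t in Y) hiT t + \sum_(t in ~: Y) hiT t)%N.
    rewrite (bigID (mem Y)) /=; congr addn.
    by apply: eq_bigl => t; rewrite !inE.
  by have := upper_condition s2 c2; clear; lia.
pose E := [set e : S * T | e.2 \in N e.1].
have nE s : neighbours E s = N s by apply/setP => t; rewrite !inE.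
exists E; split=> [Y|[s|t]].
- have [->|Y0] := eqVneq Y set0; first by rewrite p_set0.
  apply: le_trans (N_cov Y Y0) _; rewrite GammaE lez_nat.
  by apply: subset_leq_card; apply/subsetP => s; rewrite !inE nE.
- rewrite deg_inl nE; have /andP[lo_d d_hi] := N_S s; apply/andP; split.
    by apply: le_trans (lo_ge (@f_neq_pinfty _)) _; rewrite lee_fin lez_nat.
  by apply: le_trans (hi_le #|T| (gS_ge0 s)); rewrite lee_fin lez_nat.
- rewrite deg_inr; have /andP[lo_d d_hi] := N_T t.
  have -> : [set s | t \in neighbours E s] = [set s | t \in N s].
    by apply/setP => s; rewrite !inE.
  apply/andP; split.
    apply: le_trans (lo_ge (@f_neq_pinfty _)) _; rewrite lee_fin lez_nat.
    apply: leq_trans lo_d; rewrite /fT -/(loT t); case: leP => // lt.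
    by move: lt; clear; lia.
  by apply: le_trans (hi_le #|S| (gT_ge0 t)); rewrite lee_fin lez_nat.
Qed.

End Sufficiency.

Theorem theorem16 (S T : finType) (f g : S + T -> \bar int)
    (p : {set T} -> int)
    (f_neq_pinfty : forall v : S + T, f v <> +oo%E)
    (g_neq_ninfty : forall v : S + T, g v <> -oo%E)
    (le_f_g : forall v : S + T, (f v <= g v)%E)
    (p_super : pos_intersecting_supermodular p)
    (p_set0 : p set0 = 0)
    (p_le_S : forall Y : {set T}, p Y <= #|S|%:Z) :
  [/\ (exists E : {set S * T}, covers E p /\ degree_bounded E f g) <->
      (forall (Y : {set T}) (X : {set S}) (P : {set {set T}}),
         subpartition P (~: Y) ->
         condition1 f g p X Y P /\ condition2 f g p X Y P),
      fully_supermodular p ->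
      ((exists E : {set S * T}, covers E p /\ degree_bounded E f g) <->
       (forall (Y : {set T}) (X : {set S}) (P : {set {set T}}),
          subpartition P (~: Y) -> (#|P| <= 1)%N ->
          condition1 f g p X Y P /\ condition2 f g p X Y P))
    & fully_supermodular p -> monotone_nondecreasing p ->
      ((exists E : {set S * T}, covers E p /\ degree_bounded E f g) <->
       (forall (Y : {set T}) (X : {set S}) (P : {set {set T}}),
          subpartition P (~: Y) -> P = set0 \/ P = [set ~: Y] ->
          condition1 f g p X Y P /\ condition2 f g p X Y P))].
Proof.
have nec (E : {set S * T}) Y X P : covers E p /\ degree_bounded E f g ->
    subpartition P (~: Y) -> condition1 f g p X Y P /\ condition2 f g p X Y P.
  by case=> cov bnd; apply: conditions_necessary cov _ _ _ _ _ bnd.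
have suf := conditions_sufficient f_neq_pinfty le_f_g p_super p_set0 p_le_S.
(* Merging all members into one set costs no value by superadditivity, and lowers the term
   [#|P| * #|X|] to [#|X|]. The set is [cover P] in the supermodular case and [~: Y] in the monotone
   case. *)
have merge_le (X : {set S}) (P : {set {set T}}) (U : {set T}) :
    fully_supermodular p -> subpart P -> P != set0 -> p (cover P) <= p U ->
    weight p P - (#|P| * #|X|)%N%:Z
      <= weight p [set U] - (#|[set U]| * #|X|)%N%:Z.
  move=> p_full sP P0 leU; rewrite /weight big_set1 -/(weight _ _) cards1.
  have := weight_le_cover p_full p_set0 sP.
  have : (1 * #|X| <= #|P| * #|X|)%N by rewrite leq_mul2r card_gt0 P0 orbT.
  by move: leU; clear; lia.
have cover_neq0 (P : {set {set T}}) : subpart P -> P != set0 -> cover P != set0.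
  move=> sP /set0Pn[W WP]; have [x xW] := subpart_neq0 sP WP.
  by apply/set0Pn; exists x; apply/bigcupP; exists W.
have subpart1 (U : {set T}) : U != set0 -> subpart [set U].
  move=> /set0Pn U0; apply: subpartI => [A B x /set1P-> /set1P->//|A /set1P->//].
split=> [|p_full|p_full p_mono]; split=> [[E HE] Y X P sP *|small]; try exact: nec HE sP.
- exact: suf.
- apply: suf => Y X P subP; have /subpartitionP[sP sPY] := subP.
  have [P0|P0] := eqVneq P set0; first by apply: small => //; rewrite P0 cards0.
  apply: conditions_le (merge_le X P (cover P) p_full sP P0 (lexx _)) _.
  apply: small; last by rewrite cards1.
  apply/subpartitionP; rewrite {2}/cover big_set1; split=> //.
  exact/subpart1/cover_neq0.
- apply: suf => Y X P subP; have /subpartitionP[sP sPY] := subP.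
  have [P0|P0] := eqVneq P set0; first by apply: small => //; left.
  have cP0 := cover_neq0 P sP P0.
  apply: conditions_le (merge_le X P (~: Y) p_full sP P0 (p_mono _ _ cP0 sPY)) _.
  apply: small; last by right.
  apply/subpartitionP; rewrite /cover big_set1; split=> //; apply: subpart1.
  by apply: contraNneq cP0 => Y0; rewrite -subset0 -Y0.
Qed.
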